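(* Let $n\ge 1$ be an integer, let $m\in\mathbb{N}$, and let $f\in\mathcal{P}$ be a polynomial in $z,\overline{z}$, $z\in\mathbb{C}^{n}$. Then the Toeplitz operator $T_{f}$ is bounded on $F^{2,m}$ if and only if $f$ is a constant.
   Context: $\mathbb{N}$ is the set of nonnegative integers, $|z|=(\sum_{j=1}^n |z_j|^2)^{1/2}$ for $z\in\mathbb{C}^n$, and $dv$ is Lebesgue measure on $\mathbb{C}^n$. Put $dV_m(z)=\omega_{n,m}|z|^{2m}e^{-|z|^2}dv(z)$ with $\omega_{n,m}=\frac{(n-1)!}{\pi^n\Gamma(m+n)}$, and $L^2_m=L^2(\mathbb{C}^n,dV_m)$ with inner product $\langle f,g\rangle_m=\int_{\mathbb{C}^n} f\overline{g}\,dV_m$. The Fock-Sobolev space $F^{2,m}$ is the closed subspace of entire functions in $L^2_m$, with the norm $\|f\|_{2,m}=\langle f,f\rangle_m^{1/2}$; $P_m$ is the orthogonal projection from $L^2_m$ onto $F^{2,m}$. For a symbol $f$ that is a polynomial in $z,\overline z$, the Toeplitz operator is $T_f h=P_m(fh)$; it is defined at least on holomorphic polynomials $h$, which are dense in $F^{2,m}$, and is called bounded if it is bounded in $\|\cdot\|_{2,m}$ on holomorphic polynomials (i.e. extends to a bounded operator on $F^{2,m}$). The class of polynomials considered is $$\mathcal{P}=\left\{\prod_{s=1}^{n}\Big(\sum_{\beta_s\le k_s}\sum_{\gamma_s\le l_s}a_{\beta_s\gamma_s,s}\,z_s^{\beta_s}\overline{z}_s^{\gamma_s}\Big): k_s,l_s\in\mathbb{N},\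 a_{\beta_s\gamma_s,s}\in\mathbb{C}\right\},$$ i.e. products over $s=1,\dots,n$ of polynomials in $z_s,\overline{z}_s$ (sums over nonnegative integers $\beta_s,\gamma_s$). *)

(* Defs.v *)
From HB Require Import structures.
From mathcomp Require Import all_boot all_order all_algebra.
From mathcomp Require Export complex.
From mathcomp Require Import all_classical all_reals all_analysis.

Set Implicit Arguments.
Unset Strict Implicit.
Unset Printing Implicit Defensive.

Import Order.TTheory GRing.Theory Num.Theory.
Import numFieldNormedType.Exports.

Local Open Scope classical_set_scope.
Local Open Scope ring_scope.

(* A point z of C^n is a row vector 'rV[R[i]]_n.  Lebesgue measure is built on
   the measurable space n.-tuple (R * R) of tuples of pairs (Re z_j, Im z_j),
   and [cpoint] is the identification of (R^2)^n with C^n. *)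

Lemma product_sigma_finite d1 d2 (T1 : measurableType d1)
    (T2 : measurableType d2) (R : realType)
    (m1 : {sigma_finite_measure set T1 -> \bar R})
    (m2 : {sigma_finite_measure set T2 -> \bar R}) :
  sigma_finite setT (m1 \x m2)%E.
Proof.
have /sigma_finiteP[F [TF ndF Foo]] := sigma_finiteT m1.
have /sigma_finiteP[G [TG ndG Goo]] := sigma_finiteT m2.
exists (fun n => F n `*` G n).
  rewrite -setXTT TF TG predeqE => -[x y]; split.
    move=> [/= [n _ Fnx] [k _ Gky]]; exists (maxn n k) => //; split.
    - by move: x Fnx; exact/subsetPset/ndF/leq_maxl.
    - by move: y Gky; exact/subsetPset/ndG/leq_maxr.
  by move=> [n _ []/= ? ?]; split; exists n.
move=> k; have [? ?] := Foo k; have [? ?] := Goo k.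
split; first exact: measurableX.
by rewrite product_measure1E// lte_mul_pinfty// ge0_fin_numE.
Qed.

Section lebesgueR2.
Variable R : realType.

(* The library's own sigma-finite instance on [m1 \x m2] is shadowed by the one
   for subprobabilities, hence a separate name. *)
Definition lebesgueR2 :
    set (measurableTypeR R * measurableTypeR R)%type -> \bar R :=
  (@lebesgue_measure R \x @lebesgue_measure R)%E.

HB.instance Definition _ := Measure.on lebesgueR2.

HB.instance Definition _ := Measure_isSigmaFinite.Build _ _ _ lebesgueR2
  (product_sigma_finite (@lebesgue_measure R) (@lebesgue_measure R)).

End lebesgueR2.

Section cons_measure.
Context d (T : measurableType d) (R : realType) (n : nat).
Variables (m1 : {sigma_finite_measure set T -> \bar R})
          (m2 : {sigma_finite_measure set (n.-tuple T) -> \bar R}).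

Definition tuple_cons (p : T * n.-tuple T) : n.+1.-tuple T :=
  [tuple of p.1 :: p.2].

Lemma measurable_tuple_cons : measurable_fun [set: T * n.-tuple T] tuple_cons.
Proof.
exact: (measurable_cons (f := fst) (g := snd) measurable_fst measurable_snd).
Qed.

Definition cons_measure : set (n.+1.-tuple T) -> \bar R :=
  pushforward (m1 \x m2)%E tuple_cons.

Let cons_measure0 : cons_measure set0 = 0%E.
Proof. by rewrite /cons_measure /pushforward preimage_set0 measure0. Qed.

Let cons_measure_ge0 A : (0 <= cons_measure A)%E.
Proof. by rewrite /cons_measure /pushforward; exact: measure_ge0. Qed.

Let cons_measure_sigma_additive : semi_sigma_additive cons_measure.
Proof.
move=> F mF tF mUF; rewrite /cons_measure /pushforward preimage_bigcup.
have mpre A : measurable A -> measurable (tuple_cons @^-1` A).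
  by move=> mA; rewrite -[X in measurable X]setTI; exact: measurable_tuple_cons.
apply: measure_semi_sigma_additive.
- by move=> k; exact: mpre.
- apply/trivIsetP => /= i j _ _ ij; rewrite -preimage_setI.
  by move/trivIsetP : tF => /(_ _ _ _ _ ij) ->//; rewrite preimage_set0.
- by rewrite -preimage_bigcup; exact: mpre.
Qed.

HB.instance Definition _ := isMeasure.Build _ _ _ cons_measure
  cons_measure0 cons_measure_ge0 cons_measure_sigma_additive.

Let cons_measure_sigma_finite : sigma_finite setT cons_measure.
Proof.
pose uncons (t : n.+1.-tuple T) := (thead t, [tuple of behead t]).
have consK : cancel tuple_cons uncons.
  move=> [x t]; rewrite /uncons /tuple_cons theadE; congr pair.
  exact: val_inj.
have munc : measurable_fun setT uncons.
  apply: measurable_fun_pair; last exact: measurable_behead.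
  exact: measurable_tnth.
have [F FT mF] := product_sigma_finite m1 m2.
exists (fun k => uncons @^-1` F k).
  by rewrite -preimage_bigcup -FT preimage_setT.
move=> k; have [mFk Fk] := mF k; split.
  by rewrite -[X in measurable X]setTI; exact: munc.
rewrite /cons_measure /pushforward -comp_preimage.
by rewrite (_ : _ \o _ = id) ?preimage_id//; apply/funext => p; exact: consK.
Qed.

HB.instance Definition _ := Measure_isSigmaFinite.Build _ _ _ cons_measure
  cons_measure_sigma_finite.

End cons_measure.

Section fock_sobolev.
Variable R : realType.

Local Notation leb := (@lebesgue_measure R).
Local Notation R2 := (measurableTypeR R * measurableTypeR R)%type.

Fixpoint lebesgueCn (n : nat) :
    {sigma_finite_measure set (n.-tuple R2) -> \bar R} :=
  match n with
  | 0 => \d_[tuple]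
  | n'.+1 => cons_measure (@lebesgueR2 R) (lebesgueCn n')
  end.

Variables (n m : nat).

Definition cpoint (t : n.-tuple R2) : 'rV[R[i]]_n :=
  \row_j Complex (tnth t j).1 (tnth t j).2.

Definition cvnorm (z : 'rV[R[i]]_n) : R :=
  Num.sqrt (\sum_(j < n) Normc.normc (z ord0 j) ^+ 2).

(* Euler's Gamma function, for x > 0. *)
Definition Gamma (x : R) : R :=
  \int[leb]_(t in `]0, +oo[) (t `^ (x - 1) * expR (- t)).

Definition omega : R := (n.-1)`!%:R / (pi ^+ n * Gamma (m + n)%N%:R).

(* The density of dV_m with respect to Lebesgue measure dv on C^n. *)
Definition weight (z : 'rV[R[i]]_n) : R :=
  omega * cvnorm z ^+ (2 * m) * expR (- cvnorm z ^+ 2).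

(* Borel measurability, read on the real coordinates. *)
Definition measurableC (f : 'rV[R[i]]_n -> R[i]) : Prop :=
  measurable_fun [set: n.-tuple R2] (fun t => complex.Re (f (cpoint t))) /\
  measurable_fun [set: n.-tuple R2] (fun t => complex.Im (f (cpoint t))).

Definition integral_dV (f : 'rV[R[i]]_n -> R[i]) : R[i] :=
  Complex
    (\int[lebesgueCn n]_t (complex.Re (f (cpoint t)) * weight (cpoint t)))
    (\int[lebesgueCn n]_t (complex.Im (f (cpoint t)) * weight (cpoint t))).

Definition L2m (f : 'rV[R[i]]_n -> R[i]) : Prop :=
  measurableC f /\
  (\int[lebesgueCn n]_t
     (Normc.normc (f (cpoint t)) ^+ 2 * weight (cpoint t))%:E < +oo)%E.

Definition innerm (f g : 'rV[R[i]]_n -> R[i]) : R[i] :=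
  integral_dV (fun z => f z * (g z)^*).

(* <f, f>_m is a nonnegative real, so taking its real part loses nothing. *)
Definition normm (f : 'rV[R[i]]_n -> R[i]) : R :=
  Num.sqrt (complex.Re (innerm f f)).

(* The scalar field is R[i], so this is complex Frechet differentiability at
   every point.  The regular module R[i]^o carries the normed structure. *)
Definition entire (f : 'rV[R[i]]_n -> R[i]) : Prop :=
  forall z : 'rV[R[i]^o]_n,
    differentiable (f : 'rV[R[i]^o]_n -> R[i]^o) z.

Definition fock_sobolev (f : 'rV[R[i]]_n -> R[i]) : Prop :=
  entire f /\ L2m f.

(* The graph of P_m : L^2_m -> F^{2,m}; since F^{2,m} is closed in L^2_m, every
   g in L^2_m has exactly one such u. *)
Definition is_Pm (g u : 'rV[R[i]]_n -> R[i]) : Prop :=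
  [/\ L2m g, fock_sobolev u &
      forall v, fock_sobolev v -> innerm (fun z => g z - u z) v = 0].

(* The graph of T_f : h |-> P_m (f h). *)
Definition is_toeplitz (f h u : 'rV[R[i]]_n -> R[i]) : Prop :=
  is_Pm (fun z => f z * h z) u.

Definition holomorphic_polynomial (h : 'rV[R[i]]_n -> R[i]) : Prop :=
  exists (d : nat) (c : {ffun 'I_n -> 'I_d.+1} -> R[i]),
    h = fun z => \sum_(alpha : {ffun 'I_n -> 'I_d.+1})
                   c alpha * \prod_(j < n) z ord0 j ^+ alpha j.

Definition toeplitz_bounded (f : 'rV[R[i]]_n -> R[i]) : Prop :=
  exists C : R, forall h, holomorphic_polynomial h ->
    exists2 u, is_toeplitz f h u & normm u <= C * normm h.

Definition class_P (f : 'rV[R[i]]_n -> R[i]) : Prop :=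
  exists (k l : 'I_n -> nat) (a : 'I_n -> nat -> nat -> R[i]),
    f = fun z => \prod_(s < n)
          \sum_(beta < (k s).+1) \sum_(gamma < (l s).+1)
            a s beta gamma * z ord0 s ^+ beta * (z ord0 s)^* ^+ gamma.

End fock_sobolev.

(* Main.v *)
Require Import Defs.
From HB Require Import structures.
From mathcomp Require Import all_boot all_order all_algebra.
From mathcomp Require Import all_classical all_reals all_analysis.
From mathcomp Require Import measurable_realfun ring lra zify.

(** A constant symbol c gives the operator h |-> c h, which is bounded. For the
    converse, test the operator on monomials: if T_f is bounded then
    |<f h, h'>| <= K ||h|| ||h'|| for all monomials h and h', because P_m does not
    change the inner product against h' ([toeplitz_form_bounded]). It remains to
    see that this fails when f is a nonconstant product of polynomials f_s in
    z_s and its conjugate.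

    All inner products are explicit. Expanding (sum_s |z_s|^2)^m over the maps
    phi from {1..m} to {1..n} turns |z|^(2 m) e^(-|z|^2) into a finite sum of
    products of one-variable functions, with |z_s|^(2 k_s) in the s-th factor,
    k_s being the size of the fibre of phi over s. Integrals of products of
    one-variable functions factor ([tensor_dV]), and in one variable the integral
    of z^a conj(z)^b e^(-|z|^2) is a! times a positive constant if a = b and
    vanishes otherwise ([momentE]). Every inner product thus becomes a sum over phi
    of products of factorials, which can be estimated term by term.

    If some f_s vanishes then f = 0. Otherwise choose in each f_s a nonzero
    coefficient a_s of z_s^(b_s) conj(z_s)^(g_s) with b_s + g_s maximal, and put
    D = sum_s (b_s + g_s). Take h = prod_s z_s^(t + g_s) and
    h' = prod_s z_s^(t + b_s) with t large. Let W_phi = prod_s (t + k_s)!. In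
    <f h, h'> only the terms of f_s with the same difference of exponents as
    (b_s, g_s) survive, and the contribution of phi is W_phi times a polynomial in
    t of degree D whose leading coefficient prod_s a_s does not depend on phi
    ([lead_prod_lead]); hence |<f h, h'>| grows at least like t^D sum_phi W_phi
    ([combination_lower_bound]). On the other side ||h||^2 and ||h'||^2 are, up to a
    common constant factor, at most (2 t)^(sum g_s) and (2 t)^(sum b_s) times
    sum_phi W_phi ([normm_monomial_le]), so that ||h|| ||h'|| is at most of order
    t^(D / 2) sum_phi W_phi. Boundedness therefore forces D = 0
    ([toeplitz_bounded_degree0]), which means that every f_s, and hence f, is
    constant. *)

Set Implicit Arguments.
Unset Strict Implicit.
Unset Printing Implicit Defensive.

Import Order.TTheory GRing.Theory Num.Theory.
Import numFieldNormedType.Exports.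

Local Open Scope classical_set_scope.
Local Open Scope ring_scope.

Local Notation cpoint := Defs.cpoint.

(** * Integrals of complex-valued functions *)

Section complex_integral.
Context d (T : measurableType d) (R : realType).
Variable mu : {measure set T -> \bar R}.
Implicit Types (f g : T -> R[i]) (c : R[i]).

Definition cintegrable f : Prop :=
  mu.-integrable setT (EFin \o (fun x => complex.Re (f x))) /\
  mu.-integrable setT (EFin \o (fun x => complex.Im (f x))).

Definition cint f : R[i] :=
  Complex (\int[mu]_x complex.Re (f x)) (\int[mu]_x complex.Im (f x)).

Lemma cReD (x y : R[i]) : complex.Re (x + y) = complex.Re x + complex.Re y.
Proof. by case: x y => [? ?] [? ?]. Qed.

Lemma cImD (x y : R[i]) : complex.Im (x + y) = complex.Im x + complex.Im y.
Proof. by case: x y => [? ?] [? ?]. Qed.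

Lemma cReM (x y : R[i]) : complex.Re (x * y) =
  complex.Re x * complex.Re y - complex.Im x * complex.Im y.
Proof. by case: x y => [? ?] [? ?]. Qed.

Lemma cImM (x y : R[i]) : complex.Im (x * y) =
  complex.Re x * complex.Im y + complex.Im x * complex.Re y.
Proof. by case: x y => [? ?] [? ?]. Qed.

Lemma cintegrableD f g : cintegrable f -> cintegrable g ->
  cintegrable (fun x => f x + g x).
Proof.
move=> [fr fi] [gr gi]; split.
- by under eq_fun do rewrite cReD; exact: (integrableD _ fr gr).
- by under eq_fun do rewrite cImD; exact: (integrableD _ fi gi).
Qed.

Lemma cintD f g : cintegrable f -> cintegrable g ->
  cint (fun x => f x + g x) = cint f + cint g.
Proof.
move=> [fr fi] [gr gi]; rewrite /cint.
under eq_Rintegral do rewrite cReD.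
under [X in Complex _ X]eq_Rintegral do rewrite cImD.
by rewrite !RintegralD.
Qed.

Lemma cintegrableZ c f : cintegrable f -> cintegrable (fun x => c * f x).
Proof.
move=> [fr fi]; split.
- under eq_fun do rewrite cReM.
  exact: (integrableB _ (integrableZl _ _ fr) (integrableZl _ _ fi)).
- under eq_fun do rewrite cImM.
  exact: (integrableD _ (integrableZl _ _ fi) (integrableZl _ _ fr)).
Qed.

Lemma cintZ c f : cintegrable f -> cint (fun x => c * f x) = c * cint f.
Proof.
move=> [fr fi]; apply/eqP; rewrite eq_complex cReM cImM /cint /=.
apply/andP; split; apply/eqP.
- under eq_Rintegral do rewrite cReM.
  rewrite RintegralB//; try exact: (integrableZl _ _ fr);
    try exact: (integrableZl _ _ fi).
  by rewrite !RintegralZl.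
- under eq_Rintegral do rewrite cImM.
  rewrite RintegralD//; try exact: (integrableZl _ _ fr);
    try exact: (integrableZl _ _ fi).
  by rewrite !RintegralZl.
Qed.

Lemma cintegrable0 : cintegrable (fun=> 0).
Proof. by split; exact: integrable0. Qed.

Lemma cint0 : cint (fun=> 0) = 0.
Proof. by rewrite /cint /Rintegral integral0. Qed.

Lemma cintegrable_sum (I : Type) (r : seq I) (P : pred I) (F : I -> T -> R[i]) :
  (forall i, P i -> cintegrable (F i)) ->
  cintegrable (fun x => \sum_(i <- r | P i) F i x).
Proof.
move=> iF; elim: r => [|i r IH].
  by under eq_fun do rewrite big_nil; exact: cintegrable0.
case: (boolP (P i)) => Pi.
  under eq_fun do rewrite big_cons Pi.
  by apply: cintegrableD => //; exact: iF.
by under eq_fun do rewrite big_cons (negbTE Pi).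
Qed.

Lemma cint_sum (I : Type) (r : seq I) (P : pred I) (F : I -> T -> R[i]) :
  (forall i, P i -> cintegrable (F i)) ->
  cint (fun x => \sum_(i <- r | P i) F i x) = \sum_(i <- r | P i) cint (F i).
Proof.
move=> iF; elim: r => [|i r IH].
  by under eq_fun do rewrite big_nil; rewrite big_nil cint0.
rewrite big_cons; case: (boolP (P i)) => Pi.
  under eq_fun do rewrite big_cons Pi.
  rewrite cintD ?IH//; first exact: iF.
  exact: cintegrable_sum.
by under eq_fun do rewrite big_cons (negbTE Pi).
Qed.

End complex_integral.

Section tensor.
Context d1 d2 (T1 : measurableType d1) (T2 : measurableType d2) (R : realType).
Variables (m1 : {sigma_finite_measure set T1 -> \bar R})
          (m2 : {sigma_finite_measure set T2 -> \bar R}).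

Lemma measurable_tensor (f : T1 -> R) (g : T2 -> R) :
  measurable_fun setT f -> measurable_fun setT g ->
  measurable_fun [set: T1 * T2] (fun p => f p.1 * g p.2).
Proof.
move=> mf mg; apply: measurable_funM; exact: measurableT_comp.
Qed.

Lemma integrable_tensor (f : T1 -> R) (g : T2 -> R) :
  m1.-integrable setT (EFin \o f) -> m2.-integrable setT (EFin \o g) ->
  (m1 \x m2)%E.-integrable setT (EFin \o (fun p => f p.1 * g p.2)).
Proof.
move=> /integrableP[/measurable_EFinP mf fi] /integrableP[/measurable_EFinP mg gi].
apply/integrable12ltyP; first by apply/measurable_EFinP; exact: measurable_tensor.
under eq_integral => x _.
  under eq_integral => y _ do rewrite /= normrM EFinM.
  rewrite ge0_integralZl//; last first.
    by apply/measurable_EFinP; exact: measurableT_comp.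
  over.
rewrite ge0_integralZr//.
- apply: lte_mul_pinfty => //; first exact: integral_ge0.
  by rewrite ge0_fin_numE//; exact: integral_ge0.
- by apply/measurable_EFinP; exact: measurableT_comp.
- exact: integral_ge0.
Qed.

Lemma Rintegral_tensor (f : T1 -> R) (g : T2 -> R) :
  m1.-integrable setT (EFin \o f) -> m2.-integrable setT (EFin \o g) ->
  (\int[(m1 \x m2)%E]_p (f p.1 * g p.2) =
   (\int[m1]_x f x) * (\int[m2]_y g y)).
Proof.
move=> fi gi.
rewrite /Rintegral -(fubini1 (integrable_tensor fi gi)) /fubini_F/=.
under eq_integral => x _.
  under eq_integral => y _ do rewrite /= EFinM.
  rewrite integralZl//.
  rewrite -(@fineK _ (\int[m2]_y (g y)%:E)%E); last exact: integrable_fin_num.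
  over.
by rewrite integralZr// fineM//; exact: integrable_fin_num.
Qed.

Lemma cintegrable_tensor (f : T1 -> R[i]) (g : T2 -> R[i]) :
  cintegrable m1 f -> cintegrable m2 g ->
  cintegrable (m1 \x m2)%E (fun p => f p.1 * g p.2).
Proof.
move=> [fr fi] [gr gi]; split.
- under eq_fun do rewrite cReM.
  exact: (integrableB _ (integrable_tensor fr gr) (integrable_tensor fi gi)).
- under eq_fun do rewrite cImM.
  exact: (integrableD _ (integrable_tensor fr gi) (integrable_tensor fi gr)).
Qed.

Lemma cint_tensor (f : T1 -> R[i]) (g : T2 -> R[i]) :
  cintegrable m1 f -> cintegrable m2 g ->
  cint (m1 \x m2)%E (fun p => f p.1 * g p.2) = cint m1 f * cint m2 g.
Proof.
move=> [fr fi] [gr gi]; apply/eqP; rewrite eq_complex cReM cImM /cint /=.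
apply/andP; split; apply/eqP; rewrite -!Rintegral_tensor//.
- rewrite -(RintegralB _ (integrable_tensor fr gr) (integrable_tensor fi gi))//.
  by apply: eq_Rintegral => p _; exact: cReM.
- rewrite -(RintegralD _ (integrable_tensor fr gi) (integrable_tensor fi gr))//.
  by apply: eq_Rintegral => p _; exact: cImM.
Qed.

End tensor.

(** * Measurability of complex-valued functions *)

Section complex_measurable.
Context d (T : measurableType d) (R : realType).
Implicit Types (f g : T -> R[i]).

Definition cmeasurable f : Prop :=
  measurable_fun setT (fun x => complex.Re (f x)) /\
  measurable_fun setT (fun x => complex.Im (f x)).

Lemma cmeasurable_cst (c : R[i]) : cmeasurable (fun=> c).
Proof. by split; exact: measurable_cst. Qed.

Lemma cmeasurableD f g : cmeasurable f -> cmeasurable g ->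
  cmeasurable (fun x => f x + g x).
Proof.
move=> [fr fi] [gr gi]; split.
- by under eq_fun do rewrite cReD; exact: measurable_funD.
- by under eq_fun do rewrite cImD; exact: measurable_funD.
Qed.

Lemma cmeasurableM f g : cmeasurable f -> cmeasurable g ->
  cmeasurable (fun x => f x * g x).
Proof.
move=> [fr fi] [gr gi]; split.
- under eq_fun do rewrite cReM.
  by apply: measurable_funB; exact: measurable_funM.
- under eq_fun do rewrite cImM.
  by apply: measurable_funD; exact: measurable_funM.
Qed.

Lemma cmeasurableX f k : cmeasurable f -> cmeasurable (fun x => f x ^+ k).
Proof.
move=> mf; elim: k => [|k IH].
  by under eq_fun do rewrite expr0; exact: cmeasurable_cst.
by under eq_fun do rewrite exprS; exact: cmeasurableM.
Qed.

Lemma cmeasurable_conj f : cmeasurable f -> cmeasurable (fun x => (f x)^*).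
Proof.
move=> [fr fi]; split.
- rewrite (_ : (fun x => _) = (fun x => complex.Re (f x)))//.
  by apply/funext => x; case: (f x).
- rewrite (_ : (fun x => _) = (fun x => - complex.Im (f x))).
    exact: measurable_funN.
  by apply/funext => x; case: (f x).
Qed.

Lemma cmeasurable_sum (I : Type) (r : seq I) (F : I -> T -> R[i]) :
  (forall i, cmeasurable (F i)) -> cmeasurable (fun x => \sum_(i <- r) F i x).
Proof.
move=> mF; elim: r => [|i r IH].
  by under eq_fun do rewrite big_nil; exact: cmeasurable_cst.
by under eq_fun do rewrite big_cons; exact: cmeasurableD.
Qed.

Lemma cmeasurable_prod (I : Type) (r : seq I) (F : I -> T -> R[i]) :
  (forall i, cmeasurable (F i)) -> cmeasurable (fun x => \prod_(i <- r) F i x).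
Proof.
move=> mF; elim: r => [|i r IH].
  by under eq_fun do rewrite big_nil; exact: cmeasurable_cst.
by under eq_fun do rewrite big_cons; exact: cmeasurableM.
Qed.

Lemma cintegrable_cmeasurable (mu : {measure set T -> \bar R}) f :
  cintegrable mu f -> cmeasurable f.
Proof.
by move=> [/integrableP[fr _] /integrableP[fi _]]; split; exact/measurable_EFinP.
Qed.

End complex_measurable.

Lemma cmeasurable_comp d1 d2 (T1 : measurableType d1) (T2 : measurableType d2)
  (R : realType) (f : T2 -> R[i]) (p : T1 -> T2) :
  measurable_fun setT p -> cmeasurable f -> cmeasurable (fun x => f (p x)).
Proof.
by move=> mp [fr fi]; split;
  [exact: (measurableT_comp fr mp)|exact: (measurableT_comp fi mp)].
Qed.

(** * Fubini for products of one-variable functions on C^n *)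

Section cons_integral.
Context d (T : measurableType d) (R : realType) (n : nat).
Variables (m1 : {sigma_finite_measure set T -> \bar R})
          (m2 : {sigma_finite_measure set (n.-tuple T) -> \bar R}).

Lemma cintegrable_cons (F : n.+1.-tuple T -> R[i]) : cmeasurable F ->
  cintegrable (m1 \x m2)%E (fun p => F (tuple_cons p)) ->
  cintegrable (cons_measure m1 m2) F.
Proof.
move=> [mr mi] [Fr Fi].
have mc := @measurable_tuple_cons _ T n.
by split;
  [apply: (integrable_pushforward mc _ Fr)|apply: (integrable_pushforward mc _ Fi)];
  rewrite ?preimage_setT//; exact/measurable_EFinP.
Qed.

Lemma cint_cons (F : n.+1.-tuple T -> R[i]) : cmeasurable F ->
  cintegrable (m1 \x m2)%E (fun p => F (tuple_cons p)) ->
  cint (cons_measure m1 m2) F = cint (m1 \x m2)%E (fun p => F (tuple_cons p)).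
Proof.
move=> [mr mi] [Fr Fi].
have mc := @measurable_tuple_cons _ T n.
by congr Complex; congr fine;
  [apply: (integral_pushforward mc _ Fr)|apply: (integral_pushforward mc _ Fi)];
  rewrite ?preimage_setT//; exact/measurable_EFinP.
Qed.

End cons_integral.

Section product_integral.
Variable R : realType.
Local Notation R2 := (measurableTypeR R * measurableTypeR R)%type.

(** By induction on the dimension: Lebesgue measure on C^(n+1) is the image of a
    product measure, under which the first coordinate separates from the others. *)
Lemma cint_prod_tuple n (g : 'I_n -> R2 -> R[i]) :
  (forall j, cintegrable (@lebesgueR2 R) (g j)) ->
  cintegrable (lebesgueCn R n) (fun t => \prod_(j < n) g j (tnth t j)) /\
  cint (lebesgueCn R n) (fun t => \prod_(j < n) g j (tnth t j)) =
    \prod_(j < n) cint (@lebesgueR2 R) (g j).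
Proof.
elim: n g => [|n IH] g ig.
  rewrite big_ord0; under eq_fun do rewrite big_ord0.
  split.
    split; apply/integrableP; split; try exact/measurable_EFinP/measurable_cst.
    - rewrite integral_dirac//= ?diracT ?mul1e//=.
      by rewrite ltry.
    - by rewrite integral_dirac//= diracT mul1e//= ltry.
  rewrite /cint /Rintegral !integral_dirac//=.
  by rewrite indicT mul1r mulr0.
have [IH1 IH2] := IH (fun j => g (lift ord0 j)) (fun j => ig _).
have E (p : R2 * n.-tuple R2) : \prod_(j < n.+1) g j (tnth (tuple_cons p) j) =
    g ord0 p.1 * \prod_(j < n) g (lift ord0 j) (tnth p.2 j).
  rewrite big_ord_recl tnth0; congr (_ * _).
  by apply: eq_bigr => j _; rewrite tnthS.
have mF : cmeasurable (fun t : n.+1.-tuple R2 => \prod_(j < n.+1) g j (tnth t j)).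
  apply: cmeasurable_prod => j.
  apply: (@cmeasurable_comp _ _ _ R2 R (g j) (fun t => tnth t j)).
    exact: measurable_tnth.
  exact: cintegrable_cmeasurable (ig j).
have iF : cintegrable (@lebesgueR2 R \x lebesgueCn R n)%E
    (fun p => \prod_(j < n.+1) g j (tnth (tuple_cons p) j)).
  under eq_fun do rewrite E.
  exact: (cintegrable_tensor (ig ord0) IH1).
split; first exact: (cintegrable_cons mF iF).
rewrite [LHS](cint_cons mF iF) big_ord_recl -IH2 -(cint_tensor (ig ord0) IH1).
by congr cint; apply/funext => p; exact: E.
Qed.

End product_integral.

(** * Exponentials dominate powers *)

Section exponential_bound.
Variable R : realType.

Definition exp_bound (k : nat) : R := 1 + 2 ^+ k.+1 * k.+1`!%:R.

Lemma exp_bound_ge0 k : 0 <= exp_bound k.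
Proof. by rewrite addr_ge0// mulr_ge0. Qed.

(** Half of the exponential absorbs the power, since one term of the exponential
    series at t / 2 already bounds t ^ (k + 1). *)
Lemma expr_expRN_bound k (t : R) : 0 <= t ->
  t ^+ k * expR (- t) <= exp_bound k * expR (- 2^-1 * t).
Proof.
move=> t0; rewrite /exp_bound.
have -> : expR (- t) = expR (- 2^-1 * t) * expR (- 2^-1 * t).
  by rewrite -expRD; congr expR; lra.
rewrite mulrA ler_wpM2r ?expR_ge0//.
rewrite mulNr expRN ler_pdivrMr ?expR_gt0//.
have y0 : 0 <= 2^-1 * t by rewrite mulr_ge0// invr_ge0.
have h := expR_ge1Dxn k y0.
have e1 : 1 <= expR (2^-1 * t) by rewrite -[leLHS]expR0 ler_expR.
have e2 : t ^+ k.+1 <= 2 ^+ k.+1 * k.+1`!%:R * expR (2^-1 * t).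
  have f0 : 0 < k.+1`!%:R :> R by rewrite ltr0n fact_gt0.
  have : (2^-1 * t) ^+ k.+1 / k.+1`!%:R <= expR (2^-1 * t).
    by apply: le_trans h; rewrite lerDr.
  rewrite ler_pdivrMr// exprMn exprVn ler_pdivrMl ?exprn_gt0// => /le_trans; apply.
  by rewrite le_eqVlt; apply/orP; left; apply/eqP; ring.
rewrite mulrDl mul1r; apply: le_trans (lerD e1 e2).
have [t1|t1] := leP t 1.
  apply: le_trans (_ : 1 <= _); first by rewrite exprn_ile1.
  by rewrite lerDl exprn_ge0.
apply: le_trans (_ : t ^+ k.+1 <= _); last by rewrite lerDr.
by apply: ler_weXn2l; [exact: ltW|lia].
Qed.

End exponential_bound.

(** * Gaussian moments on the line *)

Section gaussian_moments.
Variable R : realType.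
Local Notation leb := (@lebesgue_measure R).

Definition gauss_moment (k : nat) : R := \int[leb]_x (x ^+ k * gauss_fun x).

Lemma expr_gauss_bound k (x : R) : `|x ^+ k * gauss_fun x| <=
  (exp_bound R 0 + exp_bound R k) * expR (- x ^+ 2 / 2).
Proof.
rewrite normrM (ger0_norm (gauss_fun_ge0 x)) normrX.
have x20 := sqr_ge0 x.
have -> : - x ^+ 2 / 2 = - 2^-1 * x ^+ 2 by lra.
rewrite mulrDl; apply: le_trans (lerD (expr_expRN_bound 0 x20) (expr_expRN_bound k x20)).
rewrite -mulrDl -/(gauss_fun x) ler_wpM2r ?gauss_fun_ge0// expr0.
rewrite -exprM -[x ^+ _](@ger0_norm R); last by rewrite exprM exprn_ge0.
rewrite normrX.
(* Small x are absorbed by the constant 1, large ones by x ^ (2 k). *)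
have [x1|x1] := leP `|x| 1.
  apply: le_trans (_ : 1 <= _); first by rewrite exprn_ile1.
  by rewrite lerDl exprn_ge0.
apply: le_trans (_ : `|x| ^+ (2 * k) <= _); last by rewrite lerDr.
by apply: ler_weXn2l; [exact: ltW|lia].
Qed.

Lemma integrable_expr_gauss k :
  leb.-integrable setT (EFin \o (fun x : R => x ^+ k * gauss_fun x)).
Proof.
pose K : R := exp_bound R 0 + exp_bound R k.
have := @integrable_normal_pdf R 0 1 => /(integrableZl measurableT (K / normal_peak 1)).
apply: le_integrable => //.
- apply/measurable_EFinP; apply: measurable_funM => //.
  exact: measurable_gauss_fun.
- move=> x _ /=; rewrite lee_fin; apply: le_trans (expr_gauss_bound k x) _.
  rewrite /normal_pdf oner_eq0 /normal_fun subr0 expr1n.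
  apply: le_trans (ler_norm _); rewrite mulrA divfK//.
  by rewrite gt_eqF// normal_peak_gt0// oner_eq0.
Qed.

(** Bounding the next power gives the decay at infinity. *)
Lemma expr_gauss_decay k : exists2 K : R, 0 <= K &
  forall x : R, 0 < `|x| -> `|x ^+ k * gauss_fun x| <= K / `|x|.
Proof.
have K0 : 0 <= exp_bound R 0 + exp_bound R k.+1.
  by rewrite addr_ge0// exp_bound_ge0.
exists (exp_bound R 0 + exp_bound R k.+1) => // x x0.
rewrite ler_pdivlMr// -normrM mulrAC -exprSr.
apply: le_trans (expr_gauss_bound k.+1 x) _.
rewrite ler_piMr// -[leRHS]expR0 ler_expR mulNr oppr_le0.
by rewrite divr_ge0// sqr_ge0.
Qed.

Lemma is_derive_expr_gauss k (x : R) :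
  is_derive x (1:R) (fun x : R => x ^+ k * gauss_fun x)
    (k%:R * (x ^+ k.-1 * gauss_fun x) - 2 * (x ^+ k.+1 * gauss_fun x)).
Proof.
have dX : is_derive x (1:R) (fun y : R => y ^+ k) (k%:R * x ^+ k.-1).
  have := is_deriveX k (is_derive_id x (1 : R)); rewrite exprfctE => h.
  by apply: (is_derive_eq h); exact: mulr1.
have dN : is_derive x (1:R) (fun y : R => - y ^+ 2) (- (2 * x)).
  have := is_deriveN (is_deriveX 2 (is_derive_id x (1 : R))).
  rewrite exprfctE => h; apply: (is_derive_eq h).
  by rewrite expr1; congr (- _); exact: mulr1.
have dg := @is_derive1_comp R expR (fun y => - y ^+ 2) x _ _
  (is_derive_expR (- x ^+ 2)) dN.
apply: (is_derive_eq (is_deriveM dX dg)).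
by rewrite /GRing.scale/= /gauss_fun (exprS x k); ring.
Qed.

(** The integrand is the derivative of x^k e^(-x^2), so its integral over [-N, N]
    is a boundary term; let N tend to infinity. *)
Lemma integral_derive_expr_gauss k :
  \int[leb]_x (k%:R * (x ^+ k.-1 * gauss_fun x) -
                2 * (x ^+ k.+1 * gauss_fun x)) = 0.
Proof.
pose F (x : R) := x ^+ k * gauss_fun x.
pose f (x : R) := k%:R * (x ^+ k.-1 * gauss_fun x) -
                2 * (x ^+ k.+1 * gauss_fun x).
have intf : leb.-integrable setT (EFin \o f).
  exact: (integrableB _ (integrableZl _ _ (integrable_expr_gauss _))
                        (integrableZl _ _ (integrable_expr_gauss _))).
have dF x : is_derive x (1:R) F (f x) by exact: is_derive_expr_gauss.
have cf : continuous f.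
  have cg j : continuous (fun x : R => x ^+ j * gauss_fun x).
    move=> x; apply: differentiable_continuous; apply/derivable1_diffP.
    exact: (@ex_derive _ _ _ _ _ _ _ (is_derive_expr_gauss j x)).
  by move=> x; apply: cvgB; apply: cvgM; try exact: cvg_cst; exact: cg.
have ftc (n : nat) : (0 < n)%N ->
    (\int[leb]_(x in `[(- n%:R)%R, n%:R%R]) (f x)%:E = (F n%:R - F (- n%:R))%:E)%E.
  move=> n0; rewrite (@continuous_FTC2 _ f F)//.
  - by rewrite gtrN// ltr0n.
  - exact: continuous_subspaceT.
  - have cF : continuous F.
      move=> x; apply: differentiable_continuous; apply/derivable1_diffP.
      exact: (@ex_derive _ _ _ _ _ _ _ (dF x)).
    split.
    + by move=> x _; exact: (@ex_derive _ _ _ _ _ _ _ (dF x)).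
    + by apply: cvg_at_right_filter; exact: cF.
    + by apply: cvg_at_left_filter; exact: cF.
  - by move=> x _; rewrite derive1E; exact: (@derive_val _ _ _ _ _ _ _ (dF x)).
have lim1 : (\int[leb]_(x in `[(- n%:R)%R, n%:R%R]) (f x)%:E)%E @[n --> \oo] -->
    (\int[leb]_x (f x)%:E)%E.
  under eq_fun do rewrite integral_mkcond.
  apply: (@dominated_cvg _ _ _ leb setT _ _ _ (fun x => `|(f x)%:E|%E)) => //.
  - move=> n; apply/(measurable_restrictT _ _).1 => //.
    by apply: measurable_funTS; case/integrableP: intf.
  - move=> x _; apply: cvg_near_cst; near=> n.
    rewrite patchE ifT// inE/= in_itv/= -ler_norml.
    near: n; exact: nbhs_infty_ger.
  - exact: integrable_abse.
  - move=> n x _; rewrite patchE; case: ifPn => // _.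
    by rewrite abse0.
have lim2 : (F n%:R - F (- n%:R)) @[n --> \oo] --> (0 : R).
  have [K K0 bK] := expr_gauss_decay k.
  apply/norm_cvg0P; apply: (@squeeze_cvgr _ _ _ _ (fun=> 0) (fun n => 2 * K * n%:R^-1)).
  - near=> n; rewrite normr_ge0/=.
    have n0 : 0 < n%:R :> R by rewrite ltr0n; near: n; exact: nbhs_infty_gt.
    have b1 := bK n%:R; have b2 := bK (- n%:R).
    rewrite normrN gtr0_norm// in b1 b2.
    apply: le_trans (ler_normB _ _) _; rewrite -mulrA mulr2n mulrDl mul1r.
    by apply: lerD; [exact: b1|exact: b2].
  - exact: cvg_cst.
  - rewrite -[X in _ --> X](mulr0 (2 * K)); apply: cvgM; first exact: cvg_cst.
    apply/cvgrVy.
      by near=> n; rewrite invr_gt0 ltr0n; near: n; exact: nbhs_infty_gt.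
    rewrite (_ : unstable.inv_fun _ = fun n : nat => n%:R); first exact: cvgr_idn.
    by apply/funext => n; rewrite /unstable.inv_fun/= invrK.
have lim3 : (\int[leb]_(x in `[(- n%:R)%R, n%:R%R]) (f x)%:E)%E @[n --> \oo] --> (0%R : R)%:E.
  have lim2' : (F n%:R - F (- n%:R))%:E @[n --> \oo] --> (0%R : R)%:E.
    by apply: cvg_EFin lim2; exact: nearW.
  apply: cvg_trans lim2'; apply: near_eq_cvg; near=> n.
  by rewrite ftc//; near: n; exact: nbhs_infty_gt.
by rewrite /Rintegral (cvg_unique _ lim1 lim3).
Unshelve. all: by end_near. Qed.

End gaussian_moments.

(** * Gaussian integrals of polynomials on the plane *)

Section gaussian_plane.
Variable R : realType.
Local Notation leb := (@lebesgue_measure R).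
Local Notation R2 := (measurableTypeR R * measurableTypeR R)%type.
Local Notation C := R[i].

(** The truncated predecessor is harmless: for k = 0 the right-hand side is 0. *)
Lemma gauss_momentS k : gauss_moment R k.+1 = k%:R / 2 * gauss_moment R k.-1.
Proof.
have := integral_derive_expr_gauss R k.
have h j (c : R) : leb.-integrable setT (EFin \o (fun x : R => c * (x ^+ j * gauss_fun x))).
  exact: (integrableZl _ _ (integrable_expr_gauss R j)).
rewrite (RintegralB _ (h _ _) (h _ _))//.
rewrite !RintegralZl//; try exact: integrable_expr_gauss.
by rewrite -/(gauss_moment R _) -/(gauss_moment R _); lra.
Qed.

Lemma gauss_moment0_gt0 : 0 < gauss_moment R 0.
Proof.
rewrite /gauss_moment /Rintegral.
under eq_integral do rewrite expr0 mul1r.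
by rewrite integralT_gauss /= sqrtr_gt0 pi_gt0.
Qed.

Definition gauss2 (w : R2) : C := (gauss_fun w.1)%:C%C * (gauss_fun w.2)%:C%C.

(** A polynomial with complex coefficients in two real variables is a polynomial
    in y whose coefficients are polynomials in x. In this form it can be
    differentiated, which is what computing Gaussian moments by parts requires. *)
Definition eval_xy (q : {poly {poly C}}) (w : R2) : C :=
  q.[(w.2%:C%C)%:P].[w.1%:C%C].

Definition gint (q : {poly {poly C}}) : C :=
  cint (@lebesgueR2 R) (fun w => eval_xy q w * gauss2 w).

Definition gintegrable (q : {poly {poly C}}) : Prop :=
  cintegrable (@lebesgueR2 R) (fun w => eval_xy q w * gauss2 w).

Lemma eval_xyD p q w : eval_xy (p + q) w = eval_xy p w + eval_xy q w.
Proof. by rewrite /eval_xy !hornerD. Qed.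

Lemma eval_xyM p q w : eval_xy (p * q) w = eval_xy p w * eval_xy q w.
Proof. by rewrite /eval_xy !hornerM. Qed.

Lemma eval_xyX p k w : eval_xy (p ^+ k) w = eval_xy p w ^+ k.
Proof. by rewrite /eval_xy !horner_exp. Qed.

Lemma eval_xyC p w : eval_xy p%:P w = p.[w.1%:C%C].
Proof. by rewrite /eval_xy hornerC. Qed.

Lemma eval_xyY w : eval_xy 'X w = w.2%:C%C.
Proof. by rewrite /eval_xy hornerX hornerC. Qed.

Definition power_gauss (k : nat) (x : R) : C := (x ^+ k * gauss_fun x)%:C%C.

Lemma cintegrable_power_gauss k : cintegrable leb (power_gauss k).
Proof. split; [exact: integrable_expr_gauss|exact: integrable0]. Qed.

Lemma cint_power_gauss k : cint leb (power_gauss k) = (gauss_moment R k)%:C%C.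
Proof. by rewrite /cint/= /Rintegral integral0. Qed.

Lemma gint_powers k l : gintegrable (('X^k)%:P * 'X^l) /\
  gint (('X^k)%:P * 'X^l) = (gauss_moment R k)%:C%C * (gauss_moment R l)%:C%C.
Proof.
have E : (fun w : R2 => eval_xy (('X^k)%:P * 'X^l) w * gauss2 w) =
    fun w => power_gauss k w.1 * power_gauss l w.2.
  apply/funext => w; rewrite eval_xyM eval_xyC hornerXn eval_xyX eval_xyY /gauss2 /power_gauss.
  by rewrite !rmorphM !rmorphXn/=; ring.
rewrite /gintegrable /gint E; split.
  exact: (cintegrable_tensor (cintegrable_power_gauss k) (cintegrable_power_gauss l)).
rewrite -!cint_power_gauss.
exact: (cint_tensor (cintegrable_power_gauss k) (cintegrable_power_gauss l)).
Qed.

Lemma gintegrableD p q : gintegrable p -> gintegrable q -> gintegrable (p + q).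
Proof.
move=> hp hq; rewrite /gintegrable; under eq_fun do rewrite eval_xyD mulrDl.
exact: cintegrableD.
Qed.

Lemma gintD p q : gintegrable p -> gintegrable q -> gint (p + q) = gint p + gint q.
Proof.
move=> hp hq; rewrite /gint; under eq_fun do rewrite eval_xyD mulrDl.
exact: cintD.
Qed.

Lemma gintegrableZ (c : C) q : gintegrable q -> gintegrable (c%:P%:P * q).
Proof.
move=> hq; rewrite /gintegrable.
under eq_fun do rewrite eval_xyM eval_xyC hornerC -mulrA.
exact: cintegrableZ.
Qed.

Lemma gintZ (c : C) q : gintegrable q -> gint (c%:P%:P * q) = c * gint q.
Proof.
move=> hq; rewrite /gint.
under eq_fun do rewrite eval_xyM eval_xyC hornerC -mulrA.
exact: cintZ.
Qed.

Lemma gintegrable0 : gintegrable 0.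
Proof.
rewrite /gintegrable; under eq_fun do rewrite /eval_xy !horner0 mul0r.
exact: cintegrable0.
Qed.

Lemma gint0 : gint 0 = 0.
Proof.
rewrite /gint; under eq_fun do rewrite /eval_xy !horner0 mul0r.
exact: cint0.
Qed.

(** Every statement below about Gaussian integrals of polynomials is linear, so
    that it suffices to check it on the products x^k y^l. *)
Lemma polyXY_ind (P : {poly {poly C}} -> Prop) :
  P 0 -> (forall p q, P p -> P q -> P (p + q)) ->
  (forall c p, P p -> P (c%:P%:P * p)) ->
  (forall k l, P (('X^k)%:P * 'X^l)) -> forall q, P q.
Proof.
move=> P0 PD PZ PM q.
rewrite -(coefK q) poly_def.
apply: big_ind => // l _.
rewrite -mul_polyC -(coefK q`_l) poly_def rmorph_sum mulr_suml.
apply: big_ind => // k _.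
rewrite -mul_polyC rmorphM -mulrA; exact/PZ/PM.
Qed.

Lemma gintegrable_poly q : gintegrable q.
Proof.
elim/polyXY_ind: q => //.
- exact: gintegrable0.
- exact: gintegrableD.
- exact: gintegrableZ.
- by move=> k l; have [] := gint_powers k l.
Qed.

Definition derivx (q : {poly {poly C}}) := map_poly (@deriv C) q.

Lemma derivxD p q : derivx (p + q) = derivx p + derivx q.
Proof. by rewrite /derivx raddfD. Qed.

Lemma derivxM p q : derivx (p * q) = derivx p * q + p * derivx q.
Proof.
apply/polyP => i; rewrite coefD coef_map !coefM raddf_sum -big_split/=.
by apply: eq_bigr => j _; rewrite derivM !coef_map.
Qed.

Lemma derivxC p : derivx p%:P = p^`()%:P.
Proof. by rewrite /derivx map_polyC. Qed.

Lemma derivxY : derivx 'X = 0.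
Proof.
apply/polyP => i; rewrite coef_map coefX coef0 /=.
by case: (i == 1%N); rewrite /= ?derivC// -?polyC1 ?derivC// -?polyC0 derivC.
Qed.

Lemma derivxYn k : derivx 'X^k = 0.
Proof.
elim: k => [|k IH]; first by rewrite expr0 -polyC1 derivxC -polyC1 derivC polyC0.
by rewrite exprS derivxM derivxY IH mul0r mulr0 addr0.
Qed.

(** Integration by parts in x against e^(-x^2 - y^2). *)
Lemma gint_ibpx q : gint ('X%:P * q) = 2^-1 * gint (derivx q).
Proof.
have I := gintegrable_poly.
elim/polyXY_ind: q.
- by rewrite mulr0 /derivx map_poly0 gint0 mulr0.
- by move=> p q hp hq; rewrite mulrDr derivxD !gintD// mulrDr hp hq.
- move=> c p hp; rewrite derivxM derivxC derivC polyC0 mul0r add0r mulrCA.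
  by rewrite !gintZ// hp mulrCA.
- move=> k l; rewrite derivxM derivxC derivxYn mulr0 addr0 derivXn.
  rewrite mulrA -rmorphM -exprS (gint_powers _ _).2 gauss_momentS.
  rewrite -(mulr_natl 'X^_) -polyC_natr polyCM -[in RHS](mulrA (_%:P%:P)).
  rewrite gintZ// (gint_powers _ _).2.
  by rewrite rmorphM/= fmorph_div/= !rmorph_nat; field.
Qed.

Lemma gint_ibpy q : gint ('X * q) = 2^-1 * gint q^`().
Proof.
have I := gintegrable_poly.
elim/polyXY_ind: q.
- by rewrite mulr0 deriv0 gint0 mulr0.
- by move=> p q hp hq; rewrite mulrDr derivD !gintD// mulrDr hp hq.
- move=> c p hp; rewrite derivM derivC mul0r add0r mulrCA.
  by rewrite !gintZ// hp mulrCA.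
- move=> k l; rewrite derivM derivC mul0r add0r derivXn.
  rewrite mulrCA -exprS (gint_powers _ _).2 gauss_momentS.
  rewrite -(mulr_natl 'X^_) -polyC_natr -polyC_natr mulrCA gintZ// (gint_powers _ _).2.
  by rewrite rmorphM/= fmorph_div/= !rmorph_nat; field.
Qed.

End gaussian_plane.

(** * Gaussian moments in z and its conjugate *)

Section complex_moments.
Variable R : realType.
Local Notation R2 := (measurableTypeR R * measurableTypeR R)%type.
Local Notation C := R[i].

(** The coordinates z = x + i y and its conjugate as polynomials in x and y. *)
Definition polyZ : {poly {poly C}} := 'X%:P + ('i%C)%:P%:P * 'X.
Definition polyZb : {poly {poly C}} := 'X%:P - ('i%C)%:P%:P * 'X.

Definition complex_of_pair (w : R2) : C := Complex w.1 w.2.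

Lemma eval_xy_Z w : eval_xy polyZ w = complex_of_pair w.
Proof.
rewrite /polyZ eval_xyD eval_xyC hornerX eval_xyM eval_xyY eval_xyC hornerC.
by rewrite /complex_of_pair; apply/eqP; rewrite eq_complex /=; apply/andP; split; apply/eqP; ring.
Qed.

Lemma eval_xy_Zb w : eval_xy polyZb w = (complex_of_pair w)^*.
Proof.
rewrite /polyZb -mulNr -!polyCN eval_xyD eval_xyC hornerX eval_xyM eval_xyY eval_xyC hornerC.
by rewrite /complex_of_pair; apply/eqP; rewrite eq_complex /=; apply/andP; split; apply/eqP; ring.
Qed.

(** Twice the Wirtinger derivative with respect to the conjugate variable. It is
    a derivation that kills z, which makes integration by parts collapse. *)
Definition derivzb (q : {poly {poly C}}) := derivx q + ('i%C)%:P%:P * q^`().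

Lemma derivzbM p q : derivzb (p * q) = derivzb p * q + p * derivzb q.
Proof. by rewrite /derivzb derivxM derivM; ring. Qed.

Lemma derivzbD p q : derivzb (p + q) = derivzb p + derivzb q.
Proof. by rewrite /derivzb derivxD derivD; ring. Qed.

Lemma derivzbC p : derivzb p%:P = p^`()%:P.
Proof. by rewrite /derivzb derivxC derivC mulr0 addr0. Qed.

Lemma derivzbY : derivzb 'X = ('i%C)%:P%:P.
Proof. by rewrite /derivzb derivxY derivX mulr1 add0r. Qed.

Lemma polyC_i2 : ('i%C : C)%:P%:P * ('i%C)%:P%:P = -1.
Proof. by rewrite -polyCM -polyCM -expr2 sqr_i !polyCN !polyC1. Qed.

Lemma derivzb_iY (c : C) : derivzb (c%:P%:P * 'X) = c%:P%:P * ('i%C)%:P%:P.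
Proof. by rewrite derivzbM derivzbC derivC derivzbY polyC0 mul0r add0r. Qed.

Lemma derivzb_Z : derivzb polyZ = 0.
Proof.
by rewrite /polyZ derivzbD derivzbC derivX derivzb_iY polyC_i2 polyC1 subrr.
Qed.

Lemma derivzb_Zb : derivzb polyZb = 2.
Proof.
rewrite /polyZb -mulNr -!polyCN derivzbD derivzbC derivX derivzb_iY polyC1.
by rewrite !polyCN mulNr polyC_i2 opprK.
Qed.

(** The value at b = 0 is right although the exponent is then truncated, because
    the coefficient vanishes. *)
Lemma derivation_exp (A : comNzRingType) (D : A -> A) (z : A) (c : A) b :
  D 1 = 0 -> (forall p q, D (p * q) = D p * q + p * D q) -> D z = c ->
  D (z ^+ b) = c * b%:R * z ^+ b.-1.
Proof.
move=> D1 DM Dz; elim: b => [|b IH]; first by rewrite expr0 D1 mulr0 mul0r.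
rewrite exprS DM Dz IH; case: b {IH} => [|b]; first by rewrite expr0 mulr0 mul0r mulr0 addr0 !mulr1.
by rewrite /= exprS -(natr1 b.+1); ring.
Qed.

Lemma derivzb1 : derivzb 1 = 0.
Proof. by rewrite -polyC1 derivzbC -polyC1 derivC polyC0. Qed.

Lemma derivzb_Zn a : derivzb (polyZ ^+ a) = 0.
Proof.
by rewrite (derivation_exp a derivzb1 derivzbM derivzb_Z) !mul0r.
Qed.

Lemma derivzb_Zbn b : derivzb (polyZb ^+ b) = 2 * b%:R * polyZb ^+ b.-1.
Proof. exact: derivation_exp derivzb1 derivzbM derivzb_Zb. Qed.

Definition moment a b : C := gint (polyZ ^+ a * polyZb ^+ b).

(** Multiplication by z = x + i y is, after integration by parts in x and in y,
    the derivative with respect to the conjugate variable. *)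
Lemma momentS a b : moment a.+1 b = b%:R * moment a b.-1.
Proof.
have I := @gintegrable_poly R.
rewrite /moment exprS {1}/polyZ -mulrA mulrDl gintD// -mulrA gintZ// gint_ibpx gint_ibpy.
rewrite mulrCA -mulrDr -(gintZ 'i%C)// -gintD//.
rewrite -/(derivzb (polyZ ^+ a * polyZb ^+ b)) derivzbM derivzb_Zn mul0r add0r.
rewrite derivzb_Zbn -mulrA mulrCA (mulrCA (polyZ ^+ a)).
have cst k : (k%:R : {poly {poly C}}) = (k%:R)%:P%:P by rewrite !polyC_natr.
by rewrite (cst 2) (cst b) !gintZ// mulrA mulVf ?mul1r// pnatr_eq0.
Qed.

Lemma moment_conj a b : moment b a = (moment a b)^*.
Proof.
have I := @gintegrable_poly R (polyZ ^+ a * polyZb ^+ b).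
rewrite /moment /gint.
have E w : eval_xy (polyZ ^+ b * polyZb ^+ a) w * gauss2 w =
   (eval_xy (polyZ ^+ a * polyZb ^+ b) w * gauss2 w)^*.
  rewrite !eval_xyM !eval_xyX eval_xy_Z eval_xy_Zb.
  rewrite rmorphM/= rmorphM/= !rmorphXn/= conjCK mulrC [in RHS]mulrC; congr (_ * _).
    by rewrite /gauss2 rmorphM/=; congr (_ * _); apply/eqP; rewrite eq_complex/= ?oppr0 !eqxx.
  by rewrite mulrC.
under eq_fun do rewrite E.
move: I; rewrite /gintegrable; set f := (X in cintegrable _ X) => -[fr fi].
have conjE (x : C) : complex.Re x^* = complex.Re x /\ complex.Im x^* = - complex.Im x.
  by case: x.
apply/eqP; rewrite eq_complex (conjE _).1 (conjE _).2 /cint /=.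
apply/andP; split; apply/eqP.
  by apply: eq_Rintegral => x _; rewrite (conjE _).1.
rewrite -mulN1r -RintegralZl//; apply: eq_Rintegral => x _.
by rewrite (conjE _).2 mulN1r.
Qed.

(** Orthogonality of the powers of z: the recursion in a lowers both exponents
    until one of them is 0, and moments with one zero exponent vanish, by the
    recursion itself or by conjugation. *)
Lemma momentE a b :
  moment a b = if a == b then a`!%:R * (gauss_moment R 0 ^+ 2)%:C%C else 0.
Proof.
elim: a b => [|a IH] [|b].
- have [_] := gint_powers R 0 0; rewrite /moment !expr0 -polyC1 => ->.
  by rewrite fact0 mul1r rmorphXn.
- by rewrite moment_conj momentS mul0r; apply/eqP; rewrite eq_complex/= oppr0 !eqxx.
- by rewrite momentS mul0r.
- rewrite momentS /= IH eqSS; case: eqP => [->|_]; last by rewrite mulr0.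
  by rewrite factS natrM mulrA.
Qed.

End complex_moments.

(** * Positivity of the normalising constant *)

Section gamma.
Variable R : realType.
Local Notation leb := (@lebesgue_measure R).

(** Gamma is defined through a real-valued integral, which would be 0 if the
    integral were infinite; so finiteness has to be established as well as a
    positive lower bound, here the integral over [1, 2]. *)
Lemma Gamma_gt0 k : 0 < Gamma (k.+1%:R : R).
Proof.
rewrite /Gamma /Rintegral.
pose f (t : R) := t `^ (k.+1%:R - 1) * expR (- t).
rewrite -/f.
have fE t : 0 <= t -> f t = t ^+ k * expR (- t).
  by move=> t0; rewrite /f -natr1 addrK powR_mulrn.
have f0 t : 0 <= f t by rewrite mulr_ge0 ?powR_ge0 ?expR_ge0.
have mf : measurable_fun setT f.
  apply: measurable_funM; first exact: measurable_powR.
  by apply: measurableT_comp => //; exact: measurable_expR.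
have fin : (\int[leb]_(t in `]0%R, +oo[) (f t)%:E < +oo)%E.
  pose K : R := exp_bound R k * 2.
  have K0 : 0 <= K by rewrite mulr_ge0// exp_bound_ge0.
  have half0 : 0 < 2^-1 :> R by rewrite invr_gt0.
  apply: le_lt_trans (_ : \int[leb]_t (K%:E * (exponential_pdf 2^-1 t)%:E) < +oo)%E.
    rewrite integral_mkcond; apply: ge0_le_integral => //.
    - by move=> x _; rewrite patchE; case: ifPn => // _; rewrite lee_fin f0.
    - apply/(measurable_restrictT _ _).1 => //.
      by apply/measurable_EFinP; exact: measurable_funTS.
    - by apply: emeasurable_funM => //; apply/measurable_EFinP; exact: measurable_exponential_pdf.
    - move=> x _; rewrite patchE; case: ifPn => [|_]; last first.
        by rewrite mule_ge0// lee_fin exponential_pdf_ge0// ltW.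
      rewrite inE/= in_itv/= andbT => /ltW x0.
      rewrite exponential_pdfE// -EFinM lee_fin fE//.
      apply: le_trans (expr_expRN_bound k x0) _.
      by rewrite /K -(mulrA _ 2) (mulrA 2) mulfV// mul1r.
  rewrite ge0_integralZl//; last 2 first.
    by apply/measurable_EFinP; exact: measurable_exponential_pdf.
    by move=> x _; rewrite lee_fin exponential_pdf_ge0// ltW.
  by rewrite integral_exponential_pdf// mule1 ltry.
rewrite fine_gt0// fin andbT.
apply: lt_le_trans (_ : \int[leb]_(t in `[1%R, 2%R]) (expR (- 2))%:E <= _)%E.
  rewrite integral_cst//= lebesgue_measure_itv/= lte_fin ltr1n.
  by rewrite -EFinD -EFinM lte_fin mulr_gt0 ?expR_gt0// subr_gt0 ltr1n.
apply: le_trans (_ : \int[leb]_(t in `[1%R, 2%R]) (f t)%:E <= _)%E.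
  apply: ge0_le_integral => //.
  - by apply/measurable_EFinP; exact: measurable_funTS.
  - move=> t /=; rewrite in_itv/= => /andP[t1 t2]; rewrite lee_fin.
    have t0 : 0 <= t by lra.
    rewrite fE// -[leLHS]mul1r ler_pM ?expR_ge0 ?exprn_ege1// ler_expR; lra.
apply: ge0_subset_integral => //.
- by apply/measurable_EFinP; exact: measurable_funTS.
- by move=> t _; rewrite lee_fin f0.
- move=> t /=; rewrite !in_itv/= andbT => /andP[t1 _]; lra.
Qed.

Lemma omega_gt0 n m : (0 < n)%N -> 0 < omega R n m.
Proof.
case: n => // n _; rewrite /omega addnS divr_gt0// ?ltr0n ?fact_gt0//.
by rewrite mulr_gt0 ?exprn_gt0 ?pi_gt0 ?Gamma_gt0.
Qed.

End gamma.

(** * The measure dV_m on products *)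

(** A multinomial expansion indexed by maps rather than by exponents: each map
    contributes with coefficient 1, and only the sizes of its fibres matter. *)
Lemma sum_expr_fibers (A : comPzRingType) (n m : nat) (a : 'I_n -> A) :
  (\sum_j a j) ^+ m =
  \sum_(phi : {ffun 'I_m -> 'I_n}) \prod_j a j ^+ #|[pred i | phi i == j]|.
Proof.
rewrite -[in LHS](card_ord m) -prodr_const bigA_distr_bigA/=.
apply: eq_bigr => phi _.
rewrite (partition_big phi xpredT)//=; apply: eq_bigr => j _.
by rewrite -prodr_const; apply: eq_bigr => i /eqP ->.
Qed.

Section dV.
Variables (R : realType) (n m : nat).
Local Notation R2 := (measurableTypeR R * measurableTypeR R)%type.
Local Notation C := R[i].
Local Notation V := 'rV[R[i]]_n.
Implicit Types f g : V -> C.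

Definition fiber_card (phi : {ffun 'I_m -> 'I_n}) (j : 'I_n) : nat :=
  #|[pred i | phi i == j]|.

Definition dV_density (t : n.-tuple R2) : C := (weight m (cpoint t))%:C%C.

Definition dV_integrable f : Prop :=
  cintegrable (lebesgueCn R n) (fun t => f (cpoint t) * dV_density t).

Lemma integral_dVE f : integral_dV m f =
  cint (lebesgueCn R n) (fun t => f (cpoint t) * dV_density t).
Proof.
rewrite /integral_dV /cint; congr Complex; apply: eq_Rintegral => t _.
- by rewrite cReM /= mulr0 subr0.
- by rewrite cImM /= mulr0 add0r.
Qed.

Lemma normc_ge0 (x : C) : 0 <= Normc.normc x.
Proof. by case: x => a b; exact: sqrtr_ge0. Qed.

Lemma normc_gt0 (x : C) : x != 0 -> 0 < Normc.normc x.
Proof.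
move=> x0; rewrite lt_neqAle normc_ge0 andbT eq_sym.
by apply: contra x0 => /eqP/Normc.eq0_normc ->.
Qed.

Lemma mulcJ_normc (x : C) : x * x^* = (Normc.normc x ^+ 2)%:C%C.
Proof.
case: x => a b; rewrite /= sqr_sqrtr ?addr_ge0 ?sqr_ge0//.
by apply/eqP; rewrite eq_complex/=; apply/andP; split; apply/eqP; ring.
Qed.

Lemma cpointE (t : n.-tuple R2) j : cpoint t ord0 j = complex_of_pair (tnth t j).
Proof. by rewrite mxE. Qed.

Lemma dV_densityE (t : n.-tuple R2) : dV_density t =
  (omega R n m)%:C%C * \sum_(phi : {ffun 'I_m -> 'I_n})
   \prod_j (eval_xy ((polyZ R * polyZb R) ^+ fiber_card phi j) (tnth t j) *
            gauss2 (tnth t j)).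
Proof.
rewrite /dV_density /weight.
have s0 : 0 <= \sum_(j < n) Normc.normc (cpoint t ord0 j) ^+ 2.
  by apply: sumr_ge0 => j _; rewrite sqr_ge0.
rewrite exprM /cvnorm sqr_sqrtr// -mulrA rmorphM; congr (_ * _).
rewrite rmorphM rmorphXn rmorph_sum/= sum_expr_fibers mulr_suml.
apply: eq_bigr => phi _; rewrite big_split/=; congr (_ * _).
  apply: eq_bigr => j _; rewrite eval_xyX eval_xyM eval_xy_Z eval_xy_Zb -cpointE.
  by rewrite mulcJ_normc.
rewrite -sumrN expR_sum rmorph_prod; apply: eq_bigr => j _.
rewrite /gauss2 -rmorphM/= /gauss_fun -expRD; congr ((expR _)%:C)%C.
by rewrite cpointE /complex_of_pair /= sqr_sqrtr ?addr_ge0 ?sqr_ge0// opprD.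
Qed.

(** The density of dV_m is a sum of products of one-variable functions, so a
    product of one-variable polynomials is integrated factor by factor. *)
Lemma tensor_dV (q : 'I_n -> {poly {poly C}}) f :
  (forall t : n.-tuple R2, f (cpoint t) = \prod_j eval_xy (q j) (tnth t j)) ->
  dV_integrable f /\ integral_dV m f = (omega R n m)%:C%C *
     \sum_(phi : {ffun 'I_m -> 'I_n})
       \prod_j gint (q j * (polyZ R * polyZb R) ^+ fiber_card phi j).
Proof.
move=> fq.
have E : (fun t => f (cpoint t) * dV_density t) = fun t =>
    (omega R n m)%:C%C * \sum_(phi : {ffun 'I_m -> 'I_n})
     \prod_j (eval_xy (q j * (polyZ R * polyZb R) ^+ fiber_card phi j) (tnth t j) *
       gauss2 (tnth t j)).
  apply/funext => t; rewrite fq dV_densityE mulrCA; congr (_ * _).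
  rewrite mulr_sumr; apply: eq_bigr => phi _; rewrite -big_split/=.
  by apply: eq_bigr => j _; rewrite eval_xyM mulrA.
have P phi := cint_prod_tuple (fun j =>
  @gintegrable_poly R (q j * (polyZ R * polyZb R) ^+ fiber_card phi j)).
rewrite integral_dVE /dV_integrable E.
have I := cintegrable_sum (index_enum _) (fun phi (_ : xpredT phi) => (P phi).1).
split; first exact: (cintegrableZ _ I).
rewrite (cintZ _ I); congr (_ * _).
rewrite (cint_sum _ (fun phi (_ : xpredT phi) => (P phi).1)).
by apply: eq_bigr => phi _; exact: (P phi).2.
Qed.

End dV.

(** * The pairing on L^2_m *)

(** The optimal s is sqrt(B / A). When A or B vanishes, a single value of s already
    contradicts x > 0. *)
Lemma amgm_sqrt (R : realType) (A B x : R) : 0 <= A -> 0 <= B ->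
  (forall s, 0 < s -> 2 * x <= s * A + s^-1 * B) -> x <= Num.sqrt A * Num.sqrt B.
Proof.
move=> A0 B0 h.
have [x0|x0] := leP x 0; first by apply: le_trans x0 _; rewrite mulr_ge0 ?sqrtr_ge0.
move: A0; rewrite le_eqVlt => /predU1P[A0|A0].
  have := h ((B + 1) / x) (divr_gt0 (ltr_wpDl B0 ltr01) x0).
  rewrite -A0 mulr0 add0r invf_div -mulrAC ler_pdivlMr ?ltr_wpDl// => h1.
  exfalso; nra.
move: B0; rewrite le_eqVlt => /predU1P[B0|B0].
  have := h (x / A) (divr_gt0 x0 A0).
  rewrite -B0 mulr0 addr0 divfK ?gt_eqF// => h1.
  exfalso; lra.
have sA : 0 < Num.sqrt A by rewrite sqrtr_gt0.
have sB : 0 < Num.sqrt B by rewrite sqrtr_gt0.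
have := h (Num.sqrt B / Num.sqrt A) (divr_gt0 sB sA).
rewrite invf_div -[X in _ * X + _](sqr_sqrtr (ltW A0)) -[X in _ + _ * X](sqr_sqrtr (ltW B0)).
have -> : Num.sqrt B / Num.sqrt A * Num.sqrt A ^+ 2 +
   Num.sqrt A / Num.sqrt B * Num.sqrt B ^+ 2 = 2 * (Num.sqrt A * Num.sqrt B).
  by field; rewrite !gt_eqF.
by rewrite ler_pM2l.
Qed.

Section L2.
Variables (R : realType) (n m : nat).
Hypothesis n_gt0 : (0 < n)%N.
Local Notation R2 := (measurableTypeR R * measurableTypeR R)%type.
Local Notation C := R[i].
Local Notation V := 'rV[R[i]]_n.
Local Notation mu := (lebesgueCn R n).
Implicit Types u v f g h : V -> C.

Lemma weight_ge0 (z : V) : 0 <= weight m z.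
Proof.
have w0 := ltW (omega_gt0 R m n_gt0).
by rewrite /weight mulr_ge0 ?expR_ge0// mulr_ge0// exprn_ge0// sqrtr_ge0.
Qed.

(** The density is the integrand of the constant function 1, which is a product of
    one-variable polynomials. *)
Lemma dV_density_cmeasurable : cmeasurable (@dV_density R n m).
Proof.
have [] := @tensor_dV R n m (fun=> 1) (fun=> 1).
  by move=> t; rewrite big1// => j _; rewrite /eval_xy !hornerE.
move=> /cintegrable_cmeasurable h _.
by move: h; under eq_fun do rewrite mul1r.
Qed.

Lemma measurable_weight :
  measurable_fun [set: n.-tuple R2] (fun t => weight m (cpoint t)).
Proof. by have [] := dV_density_cmeasurable. Qed.

Lemma measurable_normc2 u : Defs.measurableC u ->
  measurable_fun [set: n.-tuple R2] (fun t => Normc.normc (u (cpoint t)) ^+ 2).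
Proof.
move=> [mr mi].
rewrite (_ : (fun t => _) = (fun t => complex.Re (u (cpoint t)) ^+ 2 +
  complex.Im (u (cpoint t)) ^+ 2)).
  by apply: measurable_funD; exact: measurable_funX.
apply/funext => t; case: (u _) => a b /=.
by rewrite sqr_sqrtr// addr_ge0// sqr_ge0.
Qed.

Definition normc2_weight u (t : n.-tuple R2) : R :=
  Normc.normc (u (cpoint t)) ^+ 2 * weight m (cpoint t).

Lemma normc2_weight_ge0 u t : 0 <= normc2_weight u t.
Proof. by rewrite mulr_ge0 ?sqr_ge0 ?weight_ge0. Qed.

Lemma L2m_integrable u : L2m m u -> mu.-integrable setT (EFin \o normc2_weight u).
Proof.
move=> [mu_ fin]; apply/integrableP; split.
  apply/measurable_EFinP; apply: measurable_funM.
    exact: measurable_normc2.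
  exact: measurable_weight.
under eq_integral => t _ do rewrite /= ger0_norm ?normc2_weight_ge0//.
exact: fin.
Qed.

Lemma normmE u : normm m u = Num.sqrt (\int[mu]_t normc2_weight u t).
Proof.
rewrite /normm /innerm /integral_dV /=; congr Num.sqrt.
by apply: eq_Rintegral => t _; rewrite mulcJ_normc.
Qed.

Lemma Rintegral_normc2_weight_ge0 u : 0 <= \int[mu]_t normc2_weight u t.
Proof. by apply: Rintegral_ge0 => t _; exact: normc2_weight_ge0. Qed.

Lemma normm_ge0 u : 0 <= normm m u.
Proof. exact: sqrtr_ge0. Qed.

Lemma normm_sqr u : normm m u ^+ 2 = \int[mu]_t normc2_weight u t.
Proof. by rewrite normmE sqr_sqrtr// Rintegral_normc2_weight_ge0. Qed.

Lemma normm_sqr_Re u : normm m u ^+ 2 = complex.Re (innerm m u u).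
Proof.
by rewrite normm_sqr; apply: eq_Rintegral => t _; rewrite mulcJ_normc.
Qed.

Lemma ReIm_le_normc (x : C) : `|complex.Re x| <= Normc.normc x /\
  `|complex.Im x| <= Normc.normc x.
Proof.
case: x => a b /=; split.
  by rewrite -sqrtr_sqr ler_wsqrtr// lerDl sqr_ge0.
by rewrite -sqrtr_sqr ler_wsqrtr// lerDr sqr_ge0.
Qed.

Lemma normc_le_ReIm (x : C) :
  Normc.normc x <= `|complex.Re x| + `|complex.Im x|.
Proof.
case: x => a b /=.
rewrite -[leRHS]ger0_norm ?addr_ge0// -sqrtr_sqr ler_wsqrtr//.
rewrite sqrrD !real_normK ?num_real// -addrA lerD2l lerDr.
by rewrite mulrn_wge0// mulr_ge0.
Qed.

Lemma normc_conj (x : C) : Normc.normc x^* = Normc.normc x.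
Proof. by case: x => a b /=; rewrite sqrrN. Qed.

(** Cauchy-Schwarz for one real component P (the real or the imaginary part) of
    the pairing: integrate 2 |u| |v| <= s |u|^2 + |v|^2 / s and optimise in s. *)
Lemma L2_component (P : C -> R) u v : L2m m u -> L2m m v ->
  measurable_fun setT (fun t : n.-tuple R2 => P (u (cpoint t) * (v (cpoint t))^*)) ->
  (forall x, `|P x| <= Normc.normc x) ->
  mu.-integrable setT
    (EFin \o (fun t => P (u (cpoint t) * (v (cpoint t))^*) * weight m (cpoint t))) /\
  `|\int[mu]_t (P (u (cpoint t) * (v (cpoint t))^*) * weight m (cpoint t))| <=
    normm m u * normm m v.
Proof.
move=> Lu Lv mP bP.
have Iu := L2m_integrable Lu; have Iv := L2m_integrable Lv.
set F := fun t => _.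
have mF : measurable_fun setT F by apply: measurable_funM => //; exact: measurable_weight.
have bF s t : 0 < s -> 2 * `|F t| <= s * normc2_weight u t + s^-1 * normc2_weight v t.
  move=> s0; rewrite /F normrM (ger0_norm (weight_ge0 _)) /normc2_weight.
  have := weight_ge0 (cpoint t); move: (weight m (cpoint t)) => w w0.
  rewrite !(mulrA _ _ w) -mulrDl; apply: (ler_wpM2r w0).
  apply: le_trans (_ : 2 * (Normc.normc (u (cpoint t)) * Normc.normc (v (cpoint t))) <= _).
    by rewrite ler_wpM2l// (le_trans (bP _))// Normc.normcM normc_conj.
  move: (Normc.normc (u _)) (Normc.normc (v _)) => a b.
  rewrite -subr_ge0.
  have -> : s * a ^+ 2 + s^-1 * b ^+ 2 - 2 * (a * b) = s * (a - s^-1 * b) ^+ 2.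
    by field; rewrite gt_eqF.
  by rewrite mulr_ge0 ?sqr_ge0 ?ltW.
have IF : mu.-integrable setT (EFin \o F).
  apply: (le_integrable _ _ _ (integrableD measurableT Iu Iv)) => //.
    exact/measurable_EFinP.
  move=> t _ /=; rewrite lee_fin; apply: le_trans (ler_norm _).
  have := bF 1 t ltr01; rewrite invr1 !mul1r.
  have := normr_ge0 (F t); lra.
split=> //.
rewrite !normmE; apply: amgm_sqrt; try exact: Rintegral_normc2_weight_ge0.
move=> s s0.
apply: le_trans (_ : 2 * \int[mu]_t `|F t| <= _).
  by rewrite ler_wpM2l// le_normr_Rintegral.
have IFn : mu.-integrable setT (EFin \o (fun t => `|F t|)).
  exact: (integrable_abse IF).
rewrite -!RintegralZl// -RintegralD//; try exact: (integrableZl _ _ Iu);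
  try exact: (integrableZl _ _ Iv).
apply: le_Rintegral => //.
- exact: (integrableZl _ _ IFn).
- exact: (integrableD _ (integrableZl _ _ Iu) (integrableZl _ _ Iv)).
- by move=> t _; exact: bF.
Qed.

(** The factor 2 comes from bounding real and imaginary parts separately; it is
    immaterial for boundedness. *)
Lemma L2_pairing u v : L2m m u -> L2m m v ->
  dV_integrable m (fun z => u z * (v z)^*) /\
  Normc.normc (innerm m u v) <= 2 * (normm m u * normm m v).
Proof.
move=> Lu Lv.
have [mr mi] : cmeasurable (fun t : n.-tuple R2 => u (cpoint t) * (v (cpoint t))^*).
  by apply: cmeasurableM; [exact: Lu.1|apply: cmeasurable_conj; exact: Lv.1].
have [Ir br] := L2_component Lu Lv mr (fun x => (ReIm_le_normc x).1).
have [Ii bi] := L2_component Lu Lv mi (fun x => (ReIm_le_normc x).2).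
split.
  split.
  - move: Ir; congr (mu.-integrable setT (EFin \o _)); apply/funext => t.
    by rewrite [RHS]cReM mulr0 subr0.
  - move: Ii; congr (mu.-integrable setT (EFin \o _)); apply/funext => t.
    by rewrite [RHS]cImM mulr0 add0r.
apply: le_trans (normc_le_ReIm _) _.
by rewrite mulr2n mulrDl mul1r lerD.
Qed.

Lemma innermBl f g v : dV_integrable m (fun z => f z * (v z)^*) ->
  dV_integrable m (fun z => g z * (v z)^*) ->
  innerm m (fun z => f z - g z) v = innerm m f v - innerm m g v.
Proof.
move=> If Ig; rewrite /innerm !integral_dVE -mulN1r -(cintZ _ Ig).
rewrite -(cintD If (cintegrableZ _ Ig)); congr cint; apply/funext => t; ring.
Qed.

(** Since f h - P_m(f h) is orthogonal to g, the pairing of f h with g is that of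
    T_f h with g, to which Cauchy-Schwarz applies. *)
Lemma toeplitz_form_bounded f : toeplitz_bounded m f ->
  exists2 K : R, 0 <= K & forall h g,
    holomorphic_polynomial h -> fock_sobolev m g ->
    dV_integrable m (fun z => f z * h z * (g z)^*) ->
    Normc.normc (innerm m (fun z => f z * h z) g) <= K * (normm m h * normm m g).
Proof.
move=> [K bK]; exists (2 * Num.max K 0); first by rewrite mulr_ge0// le_max lexx orbT.
move=> h g ph [eg Lg] I.
have [u [_ [eu Lu] orth] nu] := bK h ph.
have [Iu bu] := L2_pairing Lu Lg.
have := orth g (conj eg Lg); rewrite innermBl// => /eqP; rewrite subr_eq0 => /eqP ->.
apply: le_trans bu _; rewrite -mulrA ler_wpM2l// mulrA ler_wpM2r ?normm_ge0//.
by apply: le_trans nu _; rewrite ler_wpM2r ?normm_ge0// le_max lexx.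
Qed.

End L2.

(** * Polynomials in the Fock-Sobolev space *)

Section entire.
Variables (R : realType) (n : nat).
Local Notation C := R[i].
Local Notation V := 'rV[R[i]]_n.
Implicit Types f g : V -> C.

Lemma entire_cst (c : C) : entire (fun=> c : C) (n := n).
Proof. by move=> z; exact: differentiable_cst. Qed.

Lemma entireD f g : entire f -> entire g -> entire (fun z => f z + g z).
Proof. by move=> hf hg z; exact: (differentiableD (hf z) (hg z)). Qed.

Lemma entireM f g : entire f -> entire g -> entire (fun z => f z * g z).
Proof. by move=> hf hg z; exact: (differentiableM (hf z) (hg z)). Qed.

Lemma entire_coord j : entire (fun z : V => z ord0 j).
Proof. by move=> z; exact: (differentiable_coord z ord0 j). Qed.

Lemma entire_sum (I : Type) (r : seq I) (F : I -> V -> C) :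
  (forall i, entire (F i)) -> entire (fun z => \sum_(i <- r) F i z).
Proof.
move=> hF; elim: r => [|i r IH].
  rewrite (_ : (fun z => _) = (fun=> 0)); first exact: entire_cst.
  by apply/funext => z; rewrite big_nil.
rewrite (_ : (fun z => _) = (fun z => F i z + \sum_(j <- r) F j z)).
  exact: entireD.
by apply/funext => z; rewrite big_cons.
Qed.

Lemma entire_prod (I : Type) (r : seq I) (F : I -> V -> C) :
  (forall i, entire (F i)) -> entire (fun z => \prod_(i <- r) F i z).
Proof.
move=> hF; elim: r => [|i r IH].
  rewrite (_ : (fun z => _) = (fun=> 1)); first exact: entire_cst.
  by apply/funext => z; rewrite big_nil.
rewrite (_ : (fun z => _) = (fun z => F i z * \prod_(j <- r) F j z)).
  exact: entireM.
by apply/funext => z; rewrite big_cons.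
Qed.

Lemma entireX f k : entire f -> entire (fun z => f z ^+ k).
Proof.
move=> hf; elim: k => [|k IH].
  rewrite (_ : (fun z => _) = (fun=> 1)); first exact: entire_cst.
  by apply/funext => z; rewrite expr0.
rewrite (_ : (fun z => _) = (fun z => f z * f z ^+ k)); first exact: entireM.
by apply/funext => z; rewrite exprS.
Qed.

End entire.

Section fock_polynomials.
Variables (R : realType) (n m : nat).
Hypothesis n_gt0 : (0 < n)%N.
Local Notation R2 := (measurableTypeR R * measurableTypeR R)%type.
Local Notation C := R[i].
Local Notation V := 'rV[R[i]]_n.
Local Notation mu := (lebesgueCn R n).
Implicit Types f g h : V -> C.

Definition monomial (alpha : 'I_n -> nat) (z : V) : C :=
  \prod_(j < n) z ord0 j ^+ alpha j.

Lemma monomial_cpoint alpha (t : n.-tuple R2) :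
  monomial alpha (cpoint t) = \prod_j eval_xy (polyZ R ^+ alpha j) (tnth t j).
Proof.
by apply: eq_bigr => j _; rewrite eval_xyX eval_xy_Z cpointE.
Qed.

Lemma monomial_conj_cpoint alpha (t : n.-tuple R2) :
  (monomial alpha (cpoint t))^* = \prod_j eval_xy (polyZb R ^+ alpha j) (tnth t j).
Proof.
rewrite rmorph_prod; apply: eq_bigr => j _.
by rewrite rmorphXn/= eval_xyX eval_xy_Zb cpointE.
Qed.

Lemma cmeasurable_coord j : cmeasurable (fun t : n.-tuple R2 => cpoint t ord0 j).
Proof.
split; under eq_fun do rewrite mxE /=.
- apply: (@measurableT_comp _ _ _ _ _ _ fst); first exact: measurable_fst.
  exact: measurable_tnth.
- apply: (@measurableT_comp _ _ _ _ _ _ snd); first exact: measurable_snd.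
  exact: measurable_tnth.
Qed.

Lemma measurableC_polynomial h : holomorphic_polynomial h -> Defs.measurableC h.
Proof.
move=> [d [c ->]].
apply: (@cmeasurable_sum _ _ _ _ _ (fun (alpha : {ffun 'I_n -> 'I_d.+1})
  (t : n.-tuple R2) => c alpha * \prod_(j < n) cpoint t ord0 j ^+ alpha j)).
move=> alpha; apply: cmeasurableM; first exact: cmeasurable_cst.
apply: (@cmeasurable_prod _ _ _ _ _ (fun (j : 'I_n)
  (t : n.-tuple R2) => cpoint t ord0 j ^+ alpha j)) => j.
exact/cmeasurableX/cmeasurable_coord.
Qed.

Lemma entire_polynomial h : holomorphic_polynomial h -> entire h.
Proof.
move=> [d [c ->]]; apply: entire_sum => alpha.
apply: entireM; first exact: entire_cst.
by apply: entire_prod => j; apply: entireX; exact: entire_coord.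
Qed.

Lemma dV_integrable_monomials (alpha beta : 'I_n -> nat) :
  dV_integrable m (fun z => monomial alpha z * (monomial beta z)^*).
Proof.
apply: (tensor_dV m (q := fun j => polyZ R ^+ alpha j * polyZb R ^+ beta j) _).1.
move=> t; rewrite monomial_cpoint monomial_conj_cpoint -big_split/=.
by apply: eq_bigr => j _; rewrite eval_xyM.
Qed.

Lemma dV_integrable_polynomial h : holomorphic_polynomial h ->
  dV_integrable m (fun z => h z * (h z)^*).
Proof.
move=> [d [c ->]]; rewrite /dV_integrable.
rewrite (_ : (fun t => _) = fun t => \sum_(alpha : {ffun 'I_n -> 'I_d.+1})
  \sum_(beta : {ffun 'I_n -> 'I_d.+1}) (c alpha * (c beta)^*) *
   (monomial (fun j => alpha j) (cpoint t) *
    (monomial (fun j => beta j) (cpoint t))^* * dV_density m t)).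
  apply: cintegrable_sum => alpha _; apply: cintegrable_sum => beta _.
  by apply: cintegrableZ; exact: dV_integrable_monomials.
apply/funext => t; rewrite rmorph_sum mulr_suml mulr_suml.
apply: eq_bigr => alpha _; rewrite mulr_sumr mulr_suml; apply: eq_bigr => beta _.
rewrite rmorphM /= -/(monomial (fun j => alpha j) (cpoint t)).
by rewrite -/(monomial (fun j => beta j) (cpoint t)) !mulrA (mulrAC (c alpha)).
Qed.

Lemma L2m_polynomial h : holomorphic_polynomial h -> L2m m h.
Proof.
move=> ph; split; first exact: measurableC_polynomial.
have [/integrableP[_ I] _] := dV_integrable_polynomial ph.
apply: le_lt_trans I.
rewrite le_eqVlt; apply/orP; left; apply/eqP; apply: eq_integral => t _ /=.
rewrite mulcJ_normc cReM /= mulr0 subr0 ger0_norm//.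
by rewrite mulr_ge0 ?sqr_ge0 ?weight_ge0.
Qed.

Lemma fock_sobolev_polynomial h : holomorphic_polynomial h -> fock_sobolev m h.
Proof. by move=> ph; split; [exact: entire_polynomial|exact: L2m_polynomial]. Qed.

Lemma holomorphic_polynomialZ (c : C) h : holomorphic_polynomial h ->
  holomorphic_polynomial (fun z => c * h z).
Proof.
move=> [d [a ->]]; exists d, (fun alpha => c * a alpha).
by apply/funext => z; rewrite mulr_sumr; apply: eq_bigr => alpha _; rewrite mulrA.
Qed.

Lemma holomorphic_polynomial_monomial alpha :
  holomorphic_polynomial (monomial alpha).
Proof.
pose d := \max_j alpha j.
exists d, (fun b => (b == [ffun j => inord (alpha j)])%:R).
apply/funext => z; rewrite (bigD1 [ffun j => inord (alpha j)])//= eqxx mul1r.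
rewrite [X in _ + X]big1 ?addr0; last by move=> b /negbTE ->; rewrite mul0r.
apply: eq_bigr => j _; rewrite ffunE inordK//.
by rewrite ltnS /d; exact: leq_bigmax.
Qed.

Lemma toeplitz_bounded_cst f : (exists c : C, forall z, f z = c) ->
  toeplitz_bounded m f.
Proof.
move=> [c fc]; exists (Normc.normc c) => h ph.
have pch := holomorphic_polynomialZ c ph.
have fE : (fun z => f z * h z) = (fun z => c * h z).
  by apply/funext => z; rewrite fc.
exists (fun z => c * h z).
  split.
  - by rewrite fE; exact: L2m_polynomial.
  - exact: fock_sobolev_polynomial.
  - move=> v _; rewrite /innerm integral_dVE -(cint0 mu); congr cint.
    by apply/funext => t; rewrite fc subrr !mul0r.
rewrite !normmE//.
have -> : \int[mu]_t normc2_weight m (fun z => c * h z) t =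
          Normc.normc c ^+ 2 * \int[mu]_t normc2_weight m h t.
  rewrite -(RintegralZl _ measurableT (L2m_integrable n_gt0 (L2m_polynomial ph))).
  by apply: eq_Rintegral => t _; rewrite /normc2_weight Normc.normcM exprMn -[LHS]mulrA.
by rewrite sqrtrM ?sqr_ge0// sqrtr_sqr ger0_norm// normc_ge0.
Qed.

End fock_polynomials.

(** * Growth of polynomials at large integers *)

Section leading_coefficients.
Variable A : comNzRingType.

(** In the convolution only the pair (a, b) of indices is within both bounds. *)
Lemma coefM_lead (p q : {poly A}) a b : (size p <= a.+1)%N -> (size q <= b.+1)%N ->
  (p * q)`_(a + b) = p`_a * q`_b.
Proof.
move=> sp sq; rewrite coefM.
have ha : (a < (a + b).+1)%N by lia.
rewrite (bigD1 (Ordinal ha))//= addKn big1 ?addr0// => j /eqP ja.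
have {}ja : (j : nat) <> a by move=> e; apply: ja; apply/val_inj.
have [ja'|ja'] := ltnP j a.
  by rewrite [X in _ * X]nth_default ?mulr0//; apply: leq_trans sq _; lia.
by rewrite nth_default ?mul0r//; apply: leq_trans sp _; lia.
Qed.

Lemma prod_lead (I : Type) (r : seq I) (p : I -> {poly A}) (d : I -> nat) :
  (forall i, size (p i) <= (d i).+1)%N ->
  (size (\prod_(i <- r) p i)%R <= (\sum_(i <- r) d i).+1)%N /\
  (\prod_(i <- r) p i)`_(\sum_(i <- r) d i)%N = \prod_(i <- r) (p i)`_(d i).
Proof.
move=> sp; elim: r => [|i r [IH1 IH2]].
  by rewrite !big_nil size_poly1 coef1.
rewrite !big_cons; split.
  apply: leq_trans (size_polyMleq _ _) _.
  by have := sp i; move: (size (p i)) (size _) IH1 => *; lia.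
by rewrite coefM_lead// IH2.
Qed.

(** The rising product (X + k + 1) ... (X + k + j), that is (t + k + j)! / (t + k)!
    as a polynomial in t. *)
Definition rising (k j : nat) : {poly A} :=
  \prod_(i < j) ('X + ((k + i).+1%:R)%:P).

Lemma rising_fact k j t :
  (t + k)`!%:R * (rising k j).[t%:R] = (t + k + j)`!%:R :> A.
Proof.
rewrite /rising; elim: j => [|j IH]; first by rewrite big_ord0 hornerC mulr1 addn0.
rewrite big_ord_recr/= hornerM mulrA IH !hornerE -natrD -natrM !addnS factS mulnC addnA.
by [].
Qed.

Lemma size_rising k j : size (rising k j) = j.+1.
Proof.
rewrite /rising (eq_bigr (fun i : 'I_j => 'X - (- ((k + i).+1%:R))%:P)).
  by rewrite size_prod_XsubC /index_enum -enumT size_enum_ord.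
by move=> i _; rewrite polyCN opprK.
Qed.

Lemma rising_lead k j : (rising k j)`_j = 1.
Proof.
have : lead_coef (rising k j) = 1.
  rewrite /rising (eq_bigr (fun i : 'I_j => 'X - (- ((k + i).+1%:R))%:P)).
    by apply/eqP/monic_prod_XsubC.
  by move=> i _; rewrite polyCN opprK.
by rewrite /lead_coef size_rising.
Qed.

End leading_coefficients.

Section growth.
Variable R : realType.
Local Notation C := R[i].
Local Notation normc := Normc.normc.

Lemma le_normc_sum (I : Type) (r : seq I) (P : pred I) (F : I -> C) :
  normc (\sum_(i <- r | P i) F i) <= \sum_(i <- r | P i) normc (F i).
Proof.
elim/big_ind2: _ => //; first by rewrite Normc.normc0.
by move=> x y u v h1 h2; apply: le_trans (le_normcD _ _) (lerD _ _).
Qed.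

Lemma normc_real (x : R) : normc (x%:C%C) = `|x|.
Proof. by rewrite /normc/= expr0n addr0 sqrtr_sqr. Qed.

Lemma normc_nat (k : nat) : normc (k%:R : C) = k%:R.
Proof. by rewrite -(rmorph_nat (real_complex R)) normc_real normr_nat. Qed.

Lemma normcX (x : C) k : normc (x ^+ k) = normc x ^+ k.
Proof.
elim: k => [|k IH]; first by rewrite !expr0 Normc.normc1.
by rewrite !exprS Normc.normcM IH.
Qed.

(** Stated without division: the error is of order t^(d-1), where d may be 0. *)
Lemma horner_lead_approx (p : {poly C}) d : (size p <= d.+1)%N ->
  exists2 K : R, 0 <= K & forall t : nat, (0 < t)%N ->
    t%:R * normc (p.[t%:R] - p`_d * t%:R ^+ d) <= K * t%:R ^+ d.
Proof.
move=> sp; exists (\sum_(i < d) normc p`_i).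
  by apply: sumr_ge0 => i _; exact: normc_ge0.
move=> t t0; rewrite (horner_coef_wide _ sp) big_ord_recr/= addrK.
apply: le_trans (_ : t%:R * \sum_(i < d) normc (p`_i * t%:R ^+ i) <= _).
  by rewrite ler_wpM2l// le_normc_sum.
rewrite mulr_sumr mulr_suml; apply: ler_sum => i _.
rewrite Normc.normcM normcX normc_nat mulrCA ler_wpM2l ?normc_ge0//.
by rewrite -exprS ler_weXn2l// ler1n.
Qed.

(** The leading terms add up to a t^d times the total weight, as the weights are
    nonnegative and the coefficient a is common; the lower-order terms amount to
    at most half of this for t beyond a threshold independent of the weights.
    This independence matters: the weights will depend on t. *)
Lemma combination_lower_bound (I : finType) (p : I -> {poly C}) (d : nat) (a : C) :
  (forall i, (size (p i) <= d.+1)%N) -> (forall i, (p i)`_d = a) -> a != 0 ->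
  exists T : nat, forall (t : nat) (w : I -> R), (T <= t)%N ->
    (forall i, 0 <= w i) ->
    normc a / 2 * (\sum_i w i) * t%:R ^+ d <=
      normc (\sum_i (w i)%:C%C * (p i).[t%:R]).
Proof.
move=> sp pa a0.
have /choice[K hK] : forall i, exists K : R, 0 <= K /\ forall t : nat, (0 < t)%N ->
    t%:R * normc ((p i).[t%:R] - a * t%:R ^+ d) <= K * t%:R ^+ d.
  by move=> i; have [K K0 hK] := horner_lead_approx (sp i); exists K; rewrite -(pa i).
pose K0 := \sum_i K i.
have K00 : 0 <= K0 by apply: sumr_ge0 => i _; have [] := hK i.
have na : 0 < normc a by exact: normc_gt0.
(* Beyond this threshold the relative error K0 / t is at most half of |a|. *)
exists (Num.truncn (2 * K0 / normc a)).+1 => t w Tt w0.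
have t0 : (0 < t)%N by exact: leq_trans Tt.
have tK : 2 * K0 <= normc a * t%:R.
  rewrite [leRHS]mulrC -ler_pdivrMr//; apply: ltW.
  apply: lt_le_trans (_ : (Num.truncn (2 * K0 / normc a)).+1%:R <= _).
    exact: truncnS_gt.
  by rewrite ler_nat.
set S := \sum_i w i.
have S0 : 0 <= S by apply: sumr_ge0.
set N := \sum_i _.
have td : 0 <= t%:R ^+ d :> R by rewrite exprn_ge0.
have dev : t%:R * normc (N - a * S%:C%C * t%:R ^+ d) <= K0 * S * t%:R ^+ d.
  have -> : N - a * S%:C%C * t%:R ^+ d =
      \sum_i (w i)%:C%C * ((p i).[t%:R] - a * t%:R ^+ d).
    rewrite /S rmorph_sum/= mulr_sumr mulr_suml -sumrB; apply: eq_bigr => i _; ring.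
  apply: le_trans (_ : t%:R * \sum_i (w i * normc ((p i).[t%:R] - a * t%:R ^+ d)) <= _).
    rewrite ler_wpM2l//; apply: le_trans (le_normc_sum _ _ _) _.
    by apply: ler_sum => i _; rewrite Normc.normcM normc_real ger0_norm.
  rewrite /S mulr_sumr !mulr_sumr !mulr_suml; apply: ler_sum => i _.
  rewrite mulrCA (mulrC K0) -[leRHS]mulrA ler_wpM2l//.
  have [Ki h] := hK i; apply: le_trans (h t t0) _; rewrite ler_wpM2r//.
  by rewrite /K0 (bigD1 i)//= lerDl; apply: sumr_ge0 => j _; have [] := hK j.
have tri : normc (a * S%:C%C * t%:R ^+ d) <= normc N + normc (N - a * S%:C%C * t%:R ^+ d).
  rewrite -[X in _ + X]normcN opprB addrC.
  by apply: le_trans (le_normcD _ _); rewrite subrK.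
rewrite !Normc.normcM normcX normc_nat normc_real (ger0_norm S0) in tri.
have tR : 0 < t%:R :> R by rewrite ltr0n.
set X := normc (N - _) in dev tri; set Y := normc N in tri *.
set Q := t%:R ^+ d in dev tri td *.
rewrite -(ler_pM2l tR).
have dev2 : 2 * (t%:R * X) <= normc a * t%:R * (S * Q).
  apply: le_trans (_ : 2 * (K0 * S * Q) <= _); first by rewrite ler_wpM2l.
  by rewrite -(mulrA K0) mulrA ler_wpM2r// mulr_ge0.
have : t%:R * (normc a * S * Q) <= t%:R * (Y + X) by rewrite ler_wpM2l.
move: dev2; rewrite mulrDr; move: (t%:R * X) (t%:R * Y) => x y.
have -> : t%:R * (normc a / 2 * S * Q) = (normc a * t%:R * (S * Q)) / 2 by field.
have -> : t%:R * (normc a * S * Q) = normc a * t%:R * (S * Q) by ring.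
move: (normc a * _ * _) => z; lra.
Qed.

End growth.

(** Each of the j additional factors is at most 2 t. *)
Lemma fact_addn_le (t k j : nat) : (k + j <= t)%N ->
  ((t + k + j)`! <= (t + k)`! * (2 * t) ^ j)%N.
Proof.
elim: j => [|j IH] h; first by rewrite addn0 muln1.
rewrite addnS factS expnSr mulnA mulnC leq_mul//; last by lia.
by apply: IH; lia.
Qed.

(** * Inner products against monomials, one variable *)

Section one_factor.
Variable R : realType.
Local Notation C := R[i].
Variables (k l : nat) (a : nat -> nat -> C).

Definition factor_poly : {poly {poly C}} :=
  \sum_(beta < k.+1) \sum_(gamma < l.+1)
    (a beta gamma)%:P%:P * (polyZ R ^+ beta * polyZb R ^+ gamma).

Lemma eval_xy_sum (I : Type) (r : seq I) (F : I -> {poly {poly C}}) w :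
  eval_xy (\sum_(i <- r) F i) w = \sum_(i <- r) eval_xy (F i) w.
Proof.
elim/big_rec2: _ => [|i p q _ <-]; first by rewrite /eval_xy !horner0.
by rewrite eval_xyD.
Qed.

Lemma gint_sum (I : Type) (r : seq I) (F : I -> {poly {poly C}}) :
  gint (\sum_(i <- r) F i) = \sum_(i <- r) gint (F i).
Proof.
elim/big_rec2: _ => [|i p q _ <-]; first exact: gint0.
by rewrite gintD//; exact: gintegrable_poly.
Qed.

Lemma eval_xy_factor_poly w : eval_xy factor_poly w =
  \sum_(beta < k.+1) \sum_(gamma < l.+1)
    a beta gamma * complex_of_pair w ^+ beta * (complex_of_pair w)^* ^+ gamma.
Proof.
rewrite eval_xy_sum; apply: eq_bigr => beta _.
rewrite eval_xy_sum; apply: eq_bigr => gamma _.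
by rewrite !eval_xyM !eval_xyX eval_xy_Z eval_xy_Zb eval_xyC hornerC mulrA.
Qed.

Lemma gint_factor_poly p q j :
  gint (factor_poly * (polyZ R ^+ p * polyZb R ^+ q) * (polyZ R * polyZb R) ^+ j) =
  \sum_(beta < k.+1) \sum_(gamma < l.+1)
    a beta gamma * moment R (beta + p + j) (gamma + q + j).
Proof.
rewrite /factor_poly -mulrA mulr_suml gint_sum; apply: eq_bigr => beta _.
rewrite mulr_suml gint_sum; apply: eq_bigr => gamma _.
rewrite -mulrA gintZ; last exact: gintegrable_poly.
congr (_ * gint _); rewrite exprMn.
by rewrite [X in _ * X]mulrACA [LHS]mulrACA !exprD !mulrA.
Qed.

Variables (b g : nat).

(** The polynomial in t by which (t + j)! is multiplied when the factor is
    paired with z^(t+g) and z^(t+b). By orthogonality only the terms with the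
    same difference of exponents as (b, g) contribute. *)
Definition lead_poly (j : nat) : {poly C} :=
  \sum_(beta < k.+1) \sum_(gamma < l.+1)
   (if (beta + g == gamma + b)%N then a beta gamma else 0) *:
     rising C j (beta + g).

Lemma gint_factor_poly_lead t j :
  gint (factor_poly * (polyZ R ^+ (t + g) * polyZb R ^+ (t + b)) *
        (polyZ R * polyZb R) ^+ j) =
  (gauss_moment R 0 ^+ 2)%:C%C * ((t + j)`!%:R * (lead_poly j).[t%:R]).
Proof.
rewrite gint_factor_poly /lead_poly horner_sum !mulr_sumr; apply: eq_bigr => beta _.
rewrite horner_sum !mulr_sumr; apply: eq_bigr => gamma _.
rewrite momentE hornerZ.
have -> : (beta + (t + g) + j == gamma + (t + b) + j)%N = (beta + g == gamma + b)%N.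
  by apply/eqP/eqP; lia.
case: ifP => _; last by rewrite !(mul0r, mulr0).
rewrite [in RHS](mulrCA _ (a _ _)) rising_fact [RHS]mulrCA; congr (_ * _).
rewrite [RHS]mulrC; congr (_`!%:R * _); lia.
Qed.

Hypotheses (bk : (b <= k)%N) (gl : (g <= l)%N).
Hypothesis max_bg : forall beta gamma, (beta <= k)%N -> (gamma <= l)%N ->
  a beta gamma != 0 -> (beta + gamma <= b + g)%N.

(** Among the terms with beta - gamma = b - g, maximality of b + g forces
    beta <= b, and the degree b + g is reached by (b, g) alone. *)
Lemma lead_poly_term (j : nat) (beta : 'I_k.+1) (gamma : 'I_l.+1) i :
  (b + g <= i)%N -> ((beta : nat), (gamma : nat), i) <> (b, g, b + g)%N ->
  (if (beta + g == gamma + b)%N then a beta gamma else 0) *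
    (rising C j (beta + g))`_i = 0.
Proof.
move=> ib ne; case: eqP => [e|_]; last by rewrite mul0r.
have [->|a0] := eqVneq (a beta gamma) 0; first by rewrite mul0r.
have h := max_bg (ltn_ord beta) (ltn_ord gamma) a0.
rewrite nth_default ?mulr0// size_rising ltnNge; apply/negP => h2.
by apply: ne; congr (_, _, _); lia.
Qed.

Lemma size_lead_poly j : (size (lead_poly j) <= (b + g).+1)%N.
Proof.
apply/leq_sizeP => i ib; rewrite coef_sum big1// => beta _.
rewrite coef_sum big1// => gamma _; rewrite coefZ.
by apply: lead_poly_term => [|[_ _ e]]; lia.
Qed.

Lemma coef_lead_poly j : (lead_poly j)`_(b + g) = a b g.
Proof.
have bk1 : (b < k.+1)%N by []. have gl1 : (g < l.+1)%N by [].
rewrite coef_sum (bigD1 (Ordinal bk1))//= [X in _ + X]big1 ?addr0; last first.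
  move=> beta /eqP nb; rewrite coef_sum big1// => gamma _; rewrite coefZ.
  by apply: lead_poly_term => // -[e _]; apply/nb/val_inj.
rewrite coef_sum (bigD1 (Ordinal gl1))//= [X in _ + X]big1 ?addr0; last first.
  move=> gamma /eqP ng; rewrite coefZ.
  by apply: (lead_poly_term j (beta := Ordinal bk1)) => // -[e]; apply/ng/val_inj.
by rewrite addnC eqxx coefZ addnC rising_lead mulr1.
Qed.

End one_factor.

(** * Unboundedness on monomials of large degree *)

Section unbounded.
Variables (R : realType) (n m : nat).
Hypothesis n_gt0 : (0 < n)%N.
Local Notation R2 := (measurableTypeR R * measurableTypeR R)%type.
Local Notation C := R[i].
Local Notation V := 'rV[R[i]]_n.
Variables (k l : 'I_n -> nat) (a : 'I_n -> nat -> nat -> C).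

Definition symbol_fun : V -> C := fun z => \prod_(s < n)
  \sum_(beta < (k s).+1) \sum_(gamma < (l s).+1)
    a s beta gamma * z ord0 s ^+ beta * (z ord0 s)^* ^+ gamma.

Lemma symbol_fun_cpoint (t : n.-tuple R2) :
  symbol_fun (cpoint t) = \prod_s eval_xy (factor_poly (k s) (l s) (a s)) (tnth t s).
Proof.
apply: eq_bigr => s _; rewrite eval_xy_factor_poly.
by apply: eq_bigr => beta _; apply: eq_bigr => gamma _; rewrite cpointE.
Qed.

Definition dV_const : R := omega R n m * (gauss_moment R 0 ^+ 2) ^+ n.

Lemma dV_const_gt0 : 0 < dV_const.
Proof. by rewrite mulr_gt0 ?omega_gt0// !exprn_gt0// gauss_moment0_gt0. Qed.

Lemma expr_prod_ord (c : C) : c ^+ n = \prod_(s < n) c.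
Proof. by rewrite prodr_const card_ord. Qed.

Lemma dV_constE :
  dV_const%:C%C = (omega R n m)%:C%C * (gauss_moment R 0 ^+ 2)%:C%C ^+ n :> C.
Proof.
by rewrite /dV_const; move: (omega R n m) => w; rewrite rmorphM rmorphXn.
Qed.

Definition fiber_weight (alpha : 'I_n -> nat) (phi : {ffun 'I_m -> 'I_n}) : R :=
  \prod_s (alpha s + fiber_card phi s)`!%:R.

Lemma normm_monomial (alpha : 'I_n -> nat) :
  normm m (@monomial R n alpha) ^+ 2 =
    dV_const * \sum_(phi : {ffun 'I_m -> 'I_n}) fiber_weight alpha phi.
Proof.
rewrite normm_sqr_Re//.
rewrite /innerm (tensor_dV m (q := fun s => polyZ R ^+ alpha s * polyZb R ^+ alpha s) _).2.
  move: dV_constE; move: dV_const => c dE.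
  rewrite (_ : _ * _ = (c * \sum_(phi : {ffun 'I_m -> 'I_n}) fiber_weight alpha phi)%:C%C)//.
  set S := \sum_phi fiber_weight alpha phi.
  transitivity (c%:C%C * S%:C%C); last by rewrite rmorphM.
  rewrite dE /S -[RHS]mulrA; congr (_ * _).
  rewrite rmorph_sum/= mulr_sumr; apply: eq_bigr => phi _.
  rewrite /fiber_weight rmorph_prod/= expr_prod_ord -big_split/=.
  apply: eq_bigr => s _.
  rewrite exprMn mulrACA -!exprD -/(moment R _ _) momentE eqxx mulrC.
  by rewrite rmorph_nat.
move=> t; rewrite monomial_conj_cpoint monomial_cpoint -big_split/=.
by apply: eq_bigr => s _; rewrite eval_xyM.
Qed.

Variables (b g : 'I_n -> nat).
Hypotheses (bk : forall s, (b s <= k s)%N) (gl : forall s, (g s <= l s)%N).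
Hypothesis max_bg : forall s beta gamma, (beta <= k s)%N -> (gamma <= l s)%N ->
  a s beta gamma != 0 -> (beta + gamma <= b s + g s)%N.
Hypothesis abg : forall s, a s (b s) (g s) != 0.

Definition lead_prod (phi : {ffun 'I_m -> 'I_n}) : {poly C} :=
  \prod_s lead_poly (k s) (l s) (a s) (b s) (g s) (fiber_card phi s).

Lemma innerm_symbol (t : nat) :
  let h := @monomial R n (fun s => t + g s)%N in
  let h' := @monomial R n (fun s => t + b s)%N in
  dV_integrable m (fun z => symbol_fun z * h z * (h' z)^*) /\
  innerm m (fun z => symbol_fun z * h z) h' = dV_const%:C%C *
    \sum_(phi : {ffun 'I_m -> 'I_n})
      (fiber_weight (fun=> t) phi)%:C%C * (lead_prod phi).[t%:R].
Proof.
move=> h h'.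
have F (u : n.-tuple R2) : symbol_fun (cpoint u) * h (cpoint u) * (h' (cpoint u))^* =
    \prod_s eval_xy (factor_poly (k s) (l s) (a s) *
      (polyZ R ^+ (t + g s) * polyZb R ^+ (t + b s))) (tnth u s).
  rewrite /h /h' symbol_fun_cpoint monomial_conj_cpoint monomial_cpoint.
  rewrite -!big_split/=.
  by apply: eq_bigr => s _; rewrite !eval_xyM mulrA.
have [I E] := tensor_dV m (q := fun s => factor_poly (k s) (l s) (a s) *
   (polyZ R ^+ (t + g s) * polyZb R ^+ (t + b s)))
   (f := fun z => symbol_fun z * h z * (h' z)^*) F.
split=> //; rewrite /innerm E.
rewrite dV_constE -[RHS]mulrA; congr (_ * _).
rewrite mulr_sumr; apply: eq_bigr => phi _.
rewrite /fiber_weight rmorph_prod/= /lead_prod horner_prod.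
rewrite expr_prod_ord -!big_split/=.
by apply: eq_bigr => s _; rewrite gint_factor_poly_lead -(rmorph_nat (real_complex R)).
Qed.

Lemma lead_prod_lead phi :
  (size (lead_prod phi) <= (\sum_s (b s + g s))%N.+1)%N /\
  (lead_prod phi)`_(\sum_s (b s + g s))%N = \prod_s a s (b s) (g s).
Proof.
have sz s : (size (lead_poly (k s) (l s) (a s) (b s) (g s) (fiber_card phi s)) <=
    (b s + g s).+1)%N.
  by apply: size_lead_poly => // beta gamma; exact: max_bg.
have [S L] := prod_lead (index_enum 'I_n) sz; split; first exact: S.
rewrite L; apply: eq_bigr => s _.
by apply: coef_lead_poly => // beta gamma; exact: max_bg.
Qed.

Lemma fiber_weight_gt0 alpha phi : 0 < fiber_weight alpha phi.
Proof. by apply: prodr_gt0 => s _; rewrite ltr0n fact_gt0. Qed.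

Lemma sum_fiber_weight_gt0 alpha : 0 < \sum_phi fiber_weight alpha phi.
Proof.
rewrite (bigD1 [ffun=> Ordinal n_gt0])//= ltr_pwDl ?fiber_weight_gt0//.
by apply: sumr_ge0 => phi _; exact/ltW/fiber_weight_gt0.
Qed.

Lemma normm_monomial_le (t : nat) (e : 'I_n -> nat) :
  (forall s, m + e s <= t)%N ->
  normm m (@monomial R n (fun s => t + e s)%N) ^+ 2 <=
  dV_const * (\sum_phi fiber_weight (fun=> t) phi) * (2 * t%:R) ^+ (\sum_s e s)%N.
Proof.
move=> et; rewrite normm_monomial.
move: dV_const (ltW dV_const_gt0) => c c0; rewrite -mulrA ler_wpM2l//.
rewrite mulr_suml; apply: ler_sum => phi _.
rewrite -natrM -prodrXr /fiber_weight -big_split/=.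
apply: ler_prod => s _; rewrite ler0n/= -natrX -natrM ler_nat.
rewrite addnAC; apply: fact_addn_le; apply: leq_trans (et s); rewrite leq_add2r.
by apply: leq_trans (max_card _) _; rewrite card_ord.
Qed.

(** Tested on monomials of large degree t, the form is at least of order t^D and
    the product of the norms at most of order t^(D/2), both relative to the sum
    of the weights of the maps phi. After squaring, t^D is bounded. *)
Lemma toeplitz_bounded_degree0 :
  toeplitz_bounded m symbol_fun -> (\sum_s (b s + g s) = 0)%N.
Proof.
move=> /(toeplitz_form_bounded n_gt0)[K K0 hK].
set D := (\sum_s (b s + g s))%N.
apply/eqP; rewrite -leqn0 leqNgt; apply/negP => D0.
pose A := \prod_s a s (b s) (g s).
have A0 : A != 0 by apply/prodf_neq0 => s _.
have [T hT] := combination_lower_bound (fun phi => (lead_prod_lead phi).1)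
  (fun phi => (lead_prod_lead phi).2) A0.
have nA : 0 < Normc.normc A by exact: normc_gt0.
(* M bounds t ^ D once the two estimates below have been squared and compared. *)
pose M := 4 * K ^+ 2 * 2 ^+ D / Normc.normc A ^+ 2.
have [t [Tt mt tM]] : exists t, [/\ (T <= t)%N, (m + D <= t)%N & M < t%:R].
  exists (T + (m + D) + (Num.truncn M).+1)%N; split.
  - by rewrite -addnA leq_addr.
  - by rewrite addnAC leq_addl.
  - by apply: lt_le_trans (truncnS_gt M) _; rewrite ler_nat leq_addl.
have t0 : (0 < t)%N by apply: leq_trans mt; apply: leq_trans D0 (leq_addl _ _).
have [I E] := innerm_symbol t.
have := hK _ _ (holomorphic_polynomial_monomial _ _)
  (fock_sobolev_polynomial m n_gt0 (holomorphic_polynomial_monomial _ _)) I.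
rewrite E Normc.normcM normc_real (gtr0_norm dV_const_gt0).
have c0 := dV_const_gt0.
set S := \sum_phi fiber_weight (fun=> t) phi.
have S0 : 0 < S := sum_fiber_weight_gt0 _.
have := hT t (fiber_weight (fun=> t)) Tt (fun phi => ltW (fiber_weight_gt0 _ _)).
rewrite -/S -/D -/A.
set N := Normc.normc (\sum_phi _) => lowN upN.
have le_e (e : 'I_n -> nat) : (forall s, e s <= b s + g s)%N ->
    forall s, (m + e s <= t)%N.
  move=> he s; have : (b s + g s <= D)%N by rewrite /D (bigD1 s)//= leq_addr.
  by move=> h; apply: leq_trans mt; rewrite leq_add2l (leq_trans (he s)).
have ng := normm_monomial_le (le_e g (fun s => leq_addl _ _)).
have nb := normm_monomial_le (le_e b (fun s => leq_addr _ _)).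
rewrite -/S in ng nb.
move: dV_const c0 upN ng nb => c c0 upN ng nb.
have tR : 0 < t%:R :> R by rewrite ltr0n.
have td : 0 < t%:R ^+ D :> R by rewrite exprn_gt0.
have N0 : 0 <= N by exact: normc_ge0.
have up2 : (c * N) ^+ 2 <= K ^+ 2 * ((c * S) ^+ 2 * (2 ^+ D * t%:R ^+ D)).
  apply: le_trans (_ : (K * (normm m (monomial (fun s => t + g s)%N) *
     normm m (monomial (fun s => t + b s)%N))) ^+ 2 <= _).
    rewrite ler_sqr// nnegrE; first by rewrite mulr_ge0// ltW.
    by rewrite mulr_ge0// mulr_ge0// normm_ge0.
  rewrite exprMn ler_wpM2l ?sqr_ge0// exprMn.
  apply: le_trans (ler_pM (sqr_ge0 _) (sqr_ge0 _) ng nb) _.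
  rewrite -exprMn /D big_split/= exprD [X in _ <= _ * X]mulrC.
  by rewrite le_eqVlt; apply/orP; left; apply/eqP; ring.
have low2 : (c * (Normc.normc A / 2 * S * t%:R ^+ D)) ^+ 2 <= (c * N) ^+ 2.
  rewrite ler_sqr ?nnegrE ?ler_pM2l//.
    by rewrite !mulr_ge0 ?ltW ?invr_gt0.
  by rewrite mulr_ge0// ltW.
have key := le_trans low2 up2.
have key2 : (c * S) ^+ 2 * t%:R ^+ D * (Normc.normc A ^+ 2 * t%:R ^+ D) <=
            (c * S) ^+ 2 * t%:R ^+ D * (4 * K ^+ 2 * 2 ^+ D).
  have := key; rewrite -(ler_pM2l (ltr0n R 4))/=.
  by congr (_ <= _); field.
rewrite ler_pM2l in key2; last by rewrite mulr_gt0// exprn_gt0// mulr_gt0.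
have : Normc.normc A ^+ 2 * t%:R ^+ D <= Normc.normc A ^+ 2 * M.
  by rewrite /M mulrCA mulfV ?mulr1// expf_neq0// gt_eqF.
rewrite ler_pM2l ?exprn_gt0// leNgt => /negP; apply.
apply: lt_le_trans tM _.
by apply: ler_eXnr => //; rewrite ler1n.
Qed.

End unbounded.

(** * Constancy of the symbol *)

Section constant.
Variables (R : realType) (n m : nat).
Hypothesis n_gt0 : (0 < n)%N.
Local Notation C := R[i].
Variables (k l : 'I_n -> nat) (a : 'I_n -> nat -> nat -> C).

Lemma exists_top_coef (k0 l0 : nat) (c : nat -> nat -> C) :
  (exists p : 'I_k0.+1 * 'I_l0.+1, c p.1 p.2 != 0) ->
  exists bg : nat * nat, [/\ (bg.1 <= k0)%N, (bg.2 <= l0)%N, c bg.1 bg.2 != 0 &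
    forall beta gamma, (beta <= k0)%N -> (gamma <= l0)%N ->
      c beta gamma != 0 -> (beta + gamma <= bg.1 + bg.2)%N].
Proof.
move=> [p0 p0c].
have [p pc pmax] := @arg_maxnP _ p0 (fun p : 'I_k0.+1 * 'I_l0.+1 => c p.1 p.2 != 0)
  (fun p => p.1 + p.2)%N p0c.
exists (val p.1, val p.2); split => //=; try exact: leq_ord.
move=> beta gamma hb hg h.
exact: (pmax (Ordinal (n := k0.+1) hb, Ordinal (n := l0.+1) hg) h).
Qed.

Lemma symbol_fun_constant : toeplitz_bounded m (symbol_fun k l a) ->
  exists c : C, forall z, symbol_fun k l a z = c.
Proof.
move=> bounded.
have [[s s0]|nz] := pselect (exists s, forall beta gamma,
    (beta <= k s)%N -> (gamma <= l s)%N -> a s beta gamma = 0).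
  exists 0 => z; rewrite /symbol_fun (bigD1 s)//= big1 ?mul0r// => beta _.
  rewrite big1// => gamma _; rewrite s0 ?mul0r//; exact: leq_ord.
have /choice[bg hbg] : forall s, exists bg : nat * nat,
    [/\ (bg.1 <= k s)%N, (bg.2 <= l s)%N, a s bg.1 bg.2 != 0 &
    forall beta gamma, (beta <= k s)%N -> (gamma <= l s)%N ->
      a s beta gamma != 0 -> (beta + gamma <= bg.1 + bg.2)%N].
  move=> s; apply: exists_top_coef; apply: contrapT => h; apply: nz.
  exists s => beta gamma hb hg; apply/eqP; apply: contrapT => /negP h1.
  apply: h; by exists (Ordinal (n := (k s).+1) hb, Ordinal (n := (l s).+1) hg).
have D0 : (\sum_s ((bg s).1 + (bg s).2) = 0)%N.
  apply: (@toeplitz_bounded_degree0 R n m n_gt0 k l a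
    (fun s => (bg s).1) (fun s => (bg s).2)) => //.
  - by move=> s; have [] := hbg s.
  - by move=> s; have [] := hbg s.
  - by move=> s beta gamma; have [_ _ _] := hbg s; exact.
  - by move=> s; have [] := hbg s.
exists (\prod_s a s 0%N 0%N) => z; apply: eq_bigr => s _.
have ds : ((bg s).1 + (bg s).2 = 0)%N.
  by apply/eqP; rewrite -leqn0 -D0 (bigD1 s)//= leq_addr.
have vanish beta gamma : (beta <= k s)%N -> (gamma <= l s)%N ->
    (0 < beta + gamma)%N -> a s beta gamma = 0.
  move=> hb hg pos; apply/eqP; apply: contraT => h.
  have [_ _ _ /(_ _ _ hb hg h)] := hbg s.
  by rewrite ds leqNgt pos.
rewrite big_ord_recl big_ord_recl /= !expr0 !mulr1.
rewrite big1 ?addr0 => [|gamma _]; last first.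
  rewrite vanish ?mul0r//; exact: (ltn_ord gamma).
rewrite big1 ?addr0// => beta _; rewrite big1// => gamma _.
rewrite vanish ?mul0r ?leq_ord//; exact: (ltn_ord beta).
Qed.

End constant.

Theorem corollary2p1 (R : realType) (n m : nat) (f : 'rV[R[i]]_n -> R[i]) :
  (0 < n)%N ->
  class_P f ->
  (toeplitz_bounded m f <-> exists c : R[i], forall z, f z = c).
Proof.
move=> n0 [k [l [a ->]]]; split.
- exact: (@symbol_fun_constant R n m n0 k l a).
- exact: toeplitz_bounded_cst.
Qed.
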